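(* Let $\lambda>0$ and $0<\nu\le1$. The solution $u_\nu$ of $\frac{\partial^{\nu}u}{\partial t^{\nu}}=\lambda^2\frac{\partial^2u}{\partial x^2}$, $x\in\mathbb{R}$, $t>0$, $u(x,0)=\delta(x)$, satisfies, for $x\neq0$, \[ u_\nu(x,t)=\frac1\nu\,\frac{\lambda^{2/\nu}t}{|x|^{2/\nu+1}}\,p_{\nu/2}\!\left(\frac{\lambda^{2/\nu}t}{|x|^{2/\nu}};\frac\nu2,1\right)=\frac{1}{\nu|x|^{2/\nu+1}}\,p_{\nu/2}\!\left(\frac{1}{|x|^{2/\nu}};\frac\nu2,\frac{1}{\lambda t^{\nu/2}}\right). \]
   Context: Fractional derivative in the Dzherbashyan–Caputo sense: $\frac{\partial^{\nu}u}{\partial t^{\nu}}(x,t)=\frac{1}{\Gamma(1-\nu)}\int_0^t (t-s)^{-\nu}\frac{\partial u}{\partial s}(x,s)\,ds$ for $0<\nu<1$, ordinary derivative for $\nu=1$. The solution is $u_\nu(x,t)=\frac{1}{2\lambda t^{\nu/2}}\sum_{k\ge0}\frac{(-|x|/(\lambda t^{\nu/2}))^k}{k!\,\Gamma(-\nu k/2+1-\nu/2)}$. For $\alpha\neq1$, the stable density is $p_\alpha(x;\gamma,\eta)=\frac{1}{2\pi}\int_{-\infty}^{+\infty}e^{-i\beta x}\exp\{-\eta|\beta|^\alpha e^{-i\frac{\pi\gamma}{2}\frac{\beta}{|\beta|}}\}\,d\beta$. *)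

(* Defs.v *)
From Stdlib Require Import Reals Factorial.
From Coquelicot Require Import Coquelicot.
Open Scope R_scope.

Definition rpow (a b : R) : R := if Req_EM_T a 0 then 0 else Rpower a b.

Fixpoint poch_prod (z : R) (n : nat) : R :=
  match n with
  | O => z
  | S m => poch_prod z m * (z + INR (S m))
  end.

(* Reciprocal Gamma function 1/Gamma(z), an entire function (equal to 0 at
   z = 0,-1,-2,...), via Gauss' limit formula
   1/Gamma(z) = lim_n z(z+1)...(z+n) / (n! n^z). *)
Definition rgamma (z : R) : R :=
  real (Lim_seq (fun n => poch_prod z n / (INR (Factorial.fact n) * rpow (INR n) z))).

Definition u_sol (lam nu x t : R) : R :=
  / (2 * lam * rpow t (nu / 2)) *
  Series (fun k => (- Rabs x / (lam * rpow t (nu / 2))) ^ k / INR (Factorial.fact k)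
                   * rgamma (- nu * INR k / 2 + 1 - nu / 2)).

Definition cexp (z : C) : C :=
  (exp (fst z) * cos (snd z), exp (fst z) * sin (snd z)).

(* beta / |beta| (the value at beta = 0 is irrelevant) *)
Definition sgn (b : R) : R := if Rlt_dec b 0 then -1 else 1.

Definition stable_integrand (alpha gam eta x : R) (b : R) : C :=
  Cmult (cexp (0, - b * x))
        (cexp (Cmult (RtoC (- eta * rpow (Rabs b) alpha))
                     (cexp (0, - (PI * gam / 2) * sgn b)))).

Definition stable_density (alpha gam eta x : R) : C :=
  Cmult (RtoC (/ (2 * PI)))
   (RInt_gen (fun b => fst (stable_integrand alpha gam eta x b))
             (Rbar_locally m_infty) (Rbar_locally p_infty),
    RInt_gen (fun b => snd (stable_integrand alpha gam eta x b))
             (Rbar_locally m_infty) (Rbar_locally p_infty)).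

(* Main.v *)
Require Import Defs.
From Stdlib Require Import Reals Factorial Lra Lia.
From Coquelicot Require Import Coquelicot.
Open Scope R_scope.

(* Put a = nu/2 <= 1/2.  The integrand of the stable density is exp(-i y beta - eta (-i beta)^a);
   rotating the half-line beta > 0 onto beta = -i r, by differentiating under the integral with
   respect to the angle, turns the density into
     (1/pi) int_0^oo exp(-y r) Im exp(-eta r^a e^(-i pi a)) dr.
   As cos(pi a) >= 0, all derivatives of rho |-> Im exp(-rho e^(-i pi a)) are bounded by 1 on rho >= 0,
   so Taylor's formula may be integrated term by term and gives the series
     (1/pi) sum_(n>=1) (-1)^(n-1) sin(pi a n) Gamma(a n + 1) eta^n y^(-a n - 1) / n!.
   The reflection formula sin(pi s) Gamma(s+1) / (pi s) = 1/Gamma(1-s), read off from the sine product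
   and Gauss' limit, identifies it with the series defining u. *)

(** * The sine product *)

(** On the real axis no expansion in powers of eta can be integrated term by term, because the
    integrals of beta^(a n) exp(-i y beta) diverge. On the rotated ray the weight exp(-y r) turns
    every term into a Gamma integral, and a <= 1/2 keeps the other factor bounded all the way to
    beta = -i r. The series of u contains reciprocal Gamma values at 1 - a(k+1), which become
    arbitrarily negative, beyond the reach of Euler's integral; reflection brings them back to
    positive arguments. Since [rgamma] is a limit of products while the expansion produces
    integrals, the two descriptions of Gamma must also be identified, which is done through the
    growth of Gamma(n+s+1). Both identities of the theorem are instances of one: up to a prefactor,
    the series depends on eta and y only through eta / y^a, and this quotient has to equal |x| /
    (lambda t^a). *)

Lemma ex_derive_continuity_pt (f : R -> R) (x : R) : ex_derive f x -> continuity_pt f x.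
Proof.
  intros H. apply continuity_pt_filterlim, (ex_derive_continuous (V := R_NormedModule)), H.
Qed.

(** Wallis' integrals with a frequency x. For large n the weight cos^n concentrates at t = 0, so the
    dependence on x fades; for n = 0 the integral is elementary and produces sin(pi x). *)
Definition wallis (n : nat) (x : R) : R :=
  RInt (fun t => cos t ^ n * cos (2 * x * t)) 0 (PI / 2).

Lemma wallis_ex (n : nat) (x a b : R) :
  ex_RInt (fun t => cos t ^ n * cos (2 * x * t)) a b.
Proof.
  apply (ex_RInt_continuous (V := R_CompleteNormedModule)); intros t _.
  apply (ex_derive_continuous (V := R_NormedModule)). auto_derive. auto.
Qed.

(** Two integrations by parts at once: [F] collects the boundary terms and vanishes at 0 and at
    pi/2. *)
Lemma wallis_rec (n : nat) (x : R) :
  INR (n + 2) * INR (n + 1) * wallis n x =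
  (INR (n + 2) ^ 2 - 4 * x ^ 2) * wallis (n + 2) x.
Proof.
  set (F := fun t => INR (n + 2) * (cos t ^ (n + 1) * sin t * cos (2 * x * t))
                     - 2 * x * (cos t ^ (n + 2) * sin (2 * x * t))).
  set (f := fun t => (INR (n + 2) ^ 2 - 4 * x ^ 2) * (cos t ^ (n + 2) * cos (2 * x * t))
                     - INR (n + 2) * INR (n + 1) * (cos t ^ n * cos (2 * x * t))).
  assert (HF : is_RInt f 0 (PI / 2) (minus (F (PI / 2)) (F 0))).
  { apply (is_RInt_derive (V := R_CompleteNormedModule)).
    - intros t _. unfold F, f. auto_derive. auto.
      replace (n + 2)%nat with (S (S n)) by lia.
      replace (n + 1)%nat with (S n) by lia.
      change (Init.Nat.pred (S (S n))) with (S n). change (Init.Nat.pred (S n)) with n.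
      assert (Hs : sin t * sin t = 1 - cos t * cos t)
        by (generalize (sin2_cos2 t); unfold Rsqr; lra).
      rewrite !S_INR. simpl pow.
      transitivity ((INR n + 1 + 1) *
        (- (INR n + 1) * cos t ^ n * (sin t * sin t) * cos (2 * x * t)
         + cos t * cos t ^ n * cos t * cos (2 * x * t))
        - 2 * x * (2 * x * (cos t * (cos t * cos t ^ n) * cos (2 * x * t)))); [ring |].
      rewrite Hs. ring.
    - intros t _. apply (ex_derive_continuous (V := R_NormedModule)).
      unfold f. auto_derive. auto. }
  assert (H0 : minus (F (PI / 2)) (F 0) = 0).
  { unfold F, minus, plus, opp; simpl. replace (2 * x * 0) with 0 by ring.
    rewrite cos_PI2, sin_0, !pow_i by lia. ring. }
  rewrite H0 in HF. apply (is_RInt_unique (V := R_CompleteNormedModule)) in HF. unfold f in HF.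
  rewrite (RInt_minus (V := R_CompleteNormedModule)) in HF.
  2, 3 : apply @ex_RInt_scal; apply wallis_ex.
  rewrite !(RInt_scal (V := R_CompleteNormedModule)) in HF by apply wallis_ex.
  unfold wallis. unfold minus, plus, opp, scal in HF; simpl in HF; unfold mult in HF; simpl in HF.
  simpl pow in *. lra.
Qed.

Fixpoint sine_prod (x : R) (n : nat) : R :=
  match n with
  | O => 1
  | S m => sine_prod x m * (1 - x ^ 2 / INR (S m) ^ 2)
  end.

Lemma wallis_step (m : nat) (x : R) :
  INR (2 * m + 1) * wallis (2 * m) x
  = 2 * (INR m + 1) * (1 - x ^ 2 / INR (S m) ^ 2) * wallis (2 * S m) x.
Proof.
  pose proof (wallis_rec (2 * m) x) as H.
  replace (2 * S m)%nat with (2 * m + 2)%nat by lia.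
  assert (E : INR (2 * m + 2) = 2 * (INR m + 1)) by (rewrite plus_INR, mult_INR; simpl; ring).
  rewrite E in H. rewrite S_INR.
  assert (0 < INR m + 1) by (pose proof (pos_INR m); lra).
  apply Rmult_eq_reg_l with (2 * (INR m + 1)); [| lra].
  rewrite <- Rmult_assoc, H. field. lra.
Qed.

Lemma wallis_pos (m : nat) : 0 < wallis (2 * m) 0.
Proof.
  induction m as [|m IH].
  - unfold wallis. rewrite RInt_ext with (g := fun _ => 1).
    rewrite RInt_const. unfold scal; simpl; unfold mult; simpl. pose proof PI_RGT_0. lra.
    intros t _. simpl. rewrite Rmult_0_r, Rmult_0_l, cos_0. ring.
  - pose proof (wallis_step m 0) as H. pose proof (pos_INR m).
    assert (0 < INR (2 * m + 1)) by (apply lt_0_INR; lia).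
    assert (0 < INR (2 * m + 1) * wallis (2 * m) 0) by (apply Rmult_lt_0_compat; auto).
    rewrite H in H2. replace (0 ^ 2 / INR (S m) ^ 2) with 0 in H2
      by (simpl; unfold Rdiv; ring).
    apply Rmult_lt_reg_l with (2 * (INR m + 1) * (1 - 0)); lra.
Qed.

(** Dividing [wallis_step] at x by [wallis_step] at 0 leaves exactly one factor 1 - x^2/(m+1)^2; the
    pi/2 is [wallis 0 0]. *)
Lemma wallis_sine_prod (m : nat) (x : R) :
  wallis 0 x * wallis (2 * m) 0 = sine_prod x m * wallis (2 * m) x * (PI / 2).
Proof.
  induction m as [|m IH].
  - assert (H : wallis 0 0 = PI / 2).
    { unfold wallis. rewrite RInt_ext with (g := fun _ => 1).
      rewrite RInt_const. unfold scal; simpl; unfold mult; simpl. lra.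
      intros t _. simpl. rewrite Rmult_0_r, Rmult_0_l, cos_0. ring. }
    simpl. rewrite H. ring.
  - pose proof (wallis_step m x) as Hx. pose proof (wallis_step m 0) as H0.
    assert (0 < INR (2 * m + 1)) by (apply lt_0_INR; lia).
    pose proof (pos_INR m).
    apply Rmult_eq_reg_l with (2 * (INR m + 1)); [| lra].
    replace (0 ^ 2 / INR (S m) ^ 2) with 0 in H0 by (simpl; unfold Rdiv; ring).
    transitivity (wallis 0 x * (INR (2 * m + 1) * wallis (2 * m) 0)).
    { rewrite H0. ring. }
    transitivity (INR (2 * m + 1) * (wallis 0 x * wallis (2 * m) 0)); [ring|].
    rewrite IH.
    transitivity (sine_prod x m * (INR (2 * m + 1) * wallis (2 * m) x) * (PI / 2)); [ring|].
    rewrite Hx. cbn [sine_prod]. ring.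
Qed.

Lemma mul_cos_le_sin (t : R) : 0 <= t <= PI / 2 -> t * cos t <= sin t.
Proof.
  intros [H0 H1].
  destruct (MVT_gen (fun t => sin t - t * cos t) 0 t (fun t => t * sin t)) as [c [Hc E]].
  - intros c _. auto_derive. auto. ring.
  - intros c _. apply ex_derive_continuity_pt. auto_derive. auto.
  - rewrite Rmin_left, Rmax_right in Hc by lra.
    rewrite sin_0 in E. 
    assert (0 <= sin c) by (apply sin_ge_0; pose proof PI_RGT_0; lra).
    assert (0 <= c * sin c * t) by (apply Rmult_le_pos; [apply Rmult_le_pos|]; lra).
    lra.
Qed.

Lemma one_sub_cos_le (v : R) : 1 - cos v <= v ^ 2 / 2.
Proof.
  replace v with (2 * (v / 2)) at 1 by field. rewrite cos_2a_sin.
  assert (Rabs (sin (v / 2)) <= Rabs (v / 2)).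
  { destruct (MVT_gen sin 0 (v / 2) cos) as [c [_ E]].
    - intros c _. auto_derive. auto. ring.
    - intros c _. apply continuity_sin.
    - rewrite sin_0, !Rminus_0_r in E. rewrite E, Rabs_mult.
      pose proof (Rabs_le_between' (cos c) 0 1). pose proof (COS_bound c).
      pose proof (Rabs_pos (v / 2)).
      assert (Rabs (cos c) <= 1) by (apply Rabs_le; lra). nra. }
  pose proof (Rsqr_le_abs_1 _ _ H). unfold Rsqr in H0. lra.
Qed.

(** Two of the cosines are spent on the estimate cos^2 t (1 - cos 2xt) <= 2 x^2 (t cos t)^2 <= 2 x^2
    sin^2 t. The integral of cos^(2m) sin^2 is the difference of two consecutive integrals at x = 0,
    which the recurrence evaluates. *)
Lemma wallis_ratio_bound (m : nat) (x : R) :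
  Rabs (wallis (2 * S m) x - wallis (2 * S m) 0)
  <= 2 * x ^ 2 / INR (2 * m + 1) * wallis (2 * S m) 0.
Proof.
  assert (HP := PI_RGT_0).
  assert (Hp : 0 < INR (2 * m + 1)) by (apply lt_0_INR; lia).
  assert (E : wallis (2 * m) 0 - wallis (2 * S m) 0 = wallis (2 * S m) 0 / INR (2 * m + 1)).
  { pose proof (wallis_step m 0) as H0.
    replace (0 ^ 2 / INR (S m) ^ 2) with 0 in H0 by (simpl; unfold Rdiv; ring).
    replace (2 * (INR m + 1)) with (INR (2 * m + 1) + 1) in H0
      by (rewrite plus_INR, mult_INR; simpl; ring).
    apply Rmult_eq_reg_l with (INR (2 * m + 1)); [| lra].
    rewrite Rmult_minus_distr_l, H0. field. lra. }
  replace (2 * x ^ 2 / INR (2 * m + 1) * wallis (2 * S m) 0)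
    with (2 * x ^ 2 * (wallis (2 * m) 0 - wallis (2 * S m) 0)) by (rewrite E; field; lra).
  unfold wallis.
  rewrite <- !(RInt_minus (V := R_CompleteNormedModule)) by apply wallis_ex.
  rewrite <- (RInt_scal (V := R_CompleteNormedModule))
    by (apply @ex_RInt_minus; apply wallis_ex).
  eapply Rle_trans; [apply abs_RInt_le; [lra | apply @ex_RInt_minus; apply wallis_ex] |].
  apply RInt_le; [lra | | |].
  - apply (ex_RInt_norm (fun t => minus _ _)).
    apply @ex_RInt_minus; apply wallis_ex.
  - apply @ex_RInt_scal. apply @ex_RInt_minus; apply wallis_ex.
  - intros t Ht. unfold minus, plus, opp, scal; simpl; unfold mult; simpl.
    rewrite Rmult_0_r, Rmult_0_l, cos_0.
    replace (m + S (m + 0))%nat with (S (2 * m)) by lia.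
    replace (m + (m + 0))%nat with (2 * m)%nat by lia. simpl pow.
    set (p := cos t ^ (m + (m + 0))).
    assert (Hc : 0 <= cos t) by (apply cos_ge_0; lra).
    assert (0 <= p) by (apply pow_le; auto).
    pose proof (one_sub_cos_le (2 * x * t)) as H1.
    pose proof (COS_bound (2 * x * t)) as H2.
    assert (H3 : t * cos t <= sin t) by (apply mul_cos_le_sin; lra).
    assert (H4 : (t * cos t) * (t * cos t) <= sin t * sin t).
    { apply Rmult_le_compat; try apply Rmult_le_pos; lra. }
    assert (Hs : sin t * sin t = 1 - cos t * cos t)
      by (generalize (sin2_cos2 t); unfold Rsqr; lra).
    replace (cos t * (cos t * p) * cos (2 * x * t) + - (cos t * (cos t * p) * 1))
      with (- (p * (cos t * cos t * (1 - cos (2 * x * t))))) by ring.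
    rewrite Rabs_Ropp, Rabs_pos_eq.
    2 : { apply Rmult_le_pos; auto. apply Rmult_le_pos; nra. }
    replace (2 * (x * (x * 1)) * (p * 1 + - (cos t * (cos t * p) * 1)))
      with (p * (2 * (x * x) * (sin t * sin t))) by (rewrite Hs; ring).
    apply Rmult_le_compat_l; auto.
    apply Rle_trans with (cos t * cos t * ((2 * x * t) ^ 2 / 2)).
    { apply Rmult_le_compat_l; auto. nra. }
    replace (cos t * cos t * ((2 * x * t) ^ 2 / 2)) with (2 * (x * x) * (t * cos t * (t * cos t)))
      by field.
    apply Rmult_le_compat_l; auto. nra.
Qed.

Lemma wallis_0 (x : R) : 2 * x * wallis 0 x = sin (PI * x).
Proof.
  unfold wallis.
  rewrite <- (RInt_scal (V := R_CompleteNormedModule)) with (l := 2 * x) by apply wallis_ex.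
  apply is_RInt_unique.
  replace (sin (PI * x)) with (minus (sin (2 * x * (PI / 2))) (sin (2 * x * 0))).
  - apply (is_RInt_derive (V := R_CompleteNormedModule) (fun t => sin (2 * x * t))).
    + intros t _. unfold scal; simpl; unfold mult; simpl. auto_derive. auto. ring.
    + intros t _. apply (ex_derive_continuous (V := R_NormedModule)).
      unfold scal; simpl; unfold mult; simpl. auto_derive. auto.
  - unfold minus, plus, opp; simpl. rewrite Rmult_0_r, sin_0.
    replace (2 * x * (PI / 2)) with (PI * x) by field. ring.
Qed.

Lemma is_lim_seq_inv_INR : is_lim_seq (fun n => / INR n) 0.
Proof. apply (is_lim_seq_inv INR p_infty); [apply is_lim_seq_INR | discriminate]. Qed.

(** The product times [rho m] is the constant sin(pi x)/(pi x), and [rho m] tends to 1. *)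
Lemma is_lim_seq_sine_prod (x : R) :
  x <> 0 -> is_lim_seq (sine_prod x) (sin (PI * x) / (PI * x)).
Proof.
  intros Hx. assert (HP := PI_RGT_0).
  set (rho := fun m => wallis (2 * m) x / wallis (2 * m) 0).
  assert (Hr : is_lim_seq rho 1).
  { apply is_lim_seq_incr_1.
    apply is_lim_seq_le_le with (u := fun m => 1 - 2 * x ^ 2 * / INR (S m))
       (w := fun m => 1 + 2 * x ^ 2 * / INR (S m)).
    - intros m. pose proof (wallis_ratio_bound m x) as H. pose proof (wallis_pos (S m)) as H0.
      assert (Rabs (rho (S m) - 1) <= 2 * x ^ 2 * / INR (S m)).
      { unfold rho. replace (wallis (2 * S m) x / wallis (2 * S m) 0 - 1)
          with ((wallis (2 * S m) x - wallis (2 * S m) 0) / wallis (2 * S m) 0) by (field; lra).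
        unfold Rdiv at 1. rewrite Rabs_mult, (Rabs_pos_eq (/ _)).
        2 : left; apply Rinv_0_lt_compat; auto.
        apply Rmult_le_reg_r with (wallis (2 * S m) 0); auto.
        rewrite Rmult_assoc, Rinv_l, Rmult_1_r by lra.
        eapply Rle_trans; [apply H |].
        apply Rmult_le_compat_r; [lra |]. unfold Rdiv.
        apply Rmult_le_compat_l; [nra |].
        apply Rinv_le_contravar; [apply lt_0_INR; lia | apply le_INR; lia]. }
      apply Rabs_le_between in H1. lra.
    - replace (Finite 1) with (Rbar_minus 1 (Rbar_mult (2 * x ^ 2) 0)) by (simpl; f_equal; ring).
      apply is_lim_seq_minus'; [apply is_lim_seq_const |].
      apply (is_lim_seq_scal_l _ _ 0).
      apply (is_lim_seq_incr_1 (fun n => / INR n)), is_lim_seq_inv_INR.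
    - replace (Finite 1) with (Rbar_plus 1 (Rbar_mult (2 * x ^ 2) 0)) by (simpl; f_equal; ring).
      apply is_lim_seq_plus'; [apply is_lim_seq_const |].
      apply (is_lim_seq_scal_l _ _ 0).
      apply (is_lim_seq_incr_1 (fun n => / INR n)), is_lim_seq_inv_INR. }
  (* For integer x the first ratio is 0, so dividing by [rho] is legitimate only eventually. *)
  assert (Hne : eventually (fun m => rho m <> 0)).
  { apply is_lim_seq_spec in Hr. destruct (Hr (mkposreal _ Rlt_0_1)) as [N HN].
    exists N. intros m Hm E. specialize (HN m Hm). rewrite E in HN. simpl in HN.
    rewrite Rminus_0_l, Rabs_Ropp, Rabs_R1 in HN. lra. }
  apply is_lim_seq_ext_loc with (u := fun m => sin (PI * x) / (PI * x) * / rho m).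
  - destruct Hne as [N HN]. exists N. intros m Hm. specialize (HN m Hm).
    pose proof (wallis_sine_prod m x) as H. pose proof (wallis_pos m).
    assert (E : wallis (2 * m) x = rho m * wallis (2 * m) 0) by (unfold rho; field; lra).
    rewrite <- (wallis_0 x). rewrite E in H.
    assert (H2 : wallis 0 x = sine_prod x m * rho m * (PI / 2)).
    { apply Rmult_eq_reg_r with (wallis (2 * m) 0); [rewrite H; ring | lra]. }
    rewrite H2. field. repeat split; auto; lra.
  - replace (Finite (sin (PI * x) / (PI * x)))
      with (Rbar_mult (sin (PI * x) / (PI * x)) (/ 1)) by (simpl; f_equal; field; lra).
    apply is_lim_seq_scal_l. apply (is_lim_seq_inv rho 1 Hr). intros E; injection E; lra.
Qed.

(** * Real powers and integrals over the half-line *)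

(** Even extension of the power, equal to 0 at 0 for every exponent. For s > 0 it is continuous on
    the whole line, so integrability is automatic on every interval, and [pw_plus] holds without
    conditions. *)
Definition pw (s r : R) : R := rpow (Rabs r) s.

Lemma rpow_pos (a b : R) : 0 < a -> rpow a b = exp (b * ln a).
Proof. intros H. unfold rpow, Rpower. destruct (Req_EM_T a 0); [lra | reflexivity]. Qed.

Lemma pw_pos (s r : R) : 0 < r -> pw s r = exp (s * ln r).
Proof. intros H. unfold pw. rewrite Rabs_pos_eq by lra. now apply rpow_pos. Qed.

Lemma pw_0 (s : R) : pw s 0 = 0.
Proof. unfold pw, rpow. rewrite Rabs_R0. destruct (Req_EM_T 0 0); lra. Qed.

Lemma pw_opp (s r : R) : pw s (- r) = pw s r.
Proof. unfold pw. now rewrite Rabs_Ropp. Qed.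

Lemma pw_abs (s r : R) : pw s (Rabs r) = pw s r.
Proof. unfold pw. now rewrite Rabs_Rabsolu. Qed.

Lemma pw_ge0 (s r : R) : 0 <= pw s r.
Proof.
  unfold pw, rpow, Rpower. destruct (Req_EM_T (Rabs r) 0); [lra | left; apply exp_pos].
Qed.

Lemma pw_plus (s s' r : R) : pw (s + s') r = pw s r * pw s' r.
Proof.
  unfold pw, rpow. destruct (Req_EM_T (Rabs r) 0); [ring | apply Rpower_plus].
Qed.

Lemma pw_1 (r : R) : pw 1 r = Rabs r.
Proof.
  unfold pw, rpow. destruct (Req_EM_T (Rabs r) 0); [auto | apply Rpower_1].
  pose proof (Rabs_pos r); lra.
Qed.

Lemma pw_succ (s r : R) : pw (s + 1) r = pw s r * Rabs r.
Proof. now rewrite pw_plus, pw_1. Qed.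

(** The exponent starts at 1 because [pw 0 0] is 0 whereas [0 ^ 0] is 1. *)
Lemma pw_pow (s r : R) (n : nat) : pw (s * INR (S n)) r = pw s r ^ S n.
Proof.
  induction n as [|n IH].
  - simpl. now rewrite !Rmult_1_r.
  - rewrite S_INR, Rmult_plus_distr_l, Rmult_1_r, pw_plus, IH. simpl. ring.
Qed.

Lemma is_derive_pw (a r : R) : 0 < r -> is_derive (pw a) r (a * pw a r / r).
Proof.
  intros Hr. apply is_derive_ext_loc with (f := fun r => exp (a * ln r)).
  - exists (mkposreal r Hr). intros z Hz. symmetry. apply pw_pos.
    unfold ball in Hz; simpl in Hz; unfold AbsRing_ball, abs, minus, plus, opp in Hz; simpl in Hz.
    apply Rabs_lt_between in Hz. lra.
  - rewrite pw_pos by auto. auto_derive; [auto |]. field. lra.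
Qed.

Lemma continuous_pw_pos (s r : R) : 0 < r -> continuous (pw s) r.
Proof.
  intros Hr. apply (ex_derive_continuous (V := R_NormedModule)).
  eexists. now apply is_derive_pw.
Qed.

Lemma continuous_pw (s r : R) : 0 < s -> continuous (pw s) r.
Proof.
  intros Hs. destruct (Rtotal_order r 0) as [H | [-> | H]].
  - apply continuous_ext with (f := fun r => pw s (- r)); [intros; apply pw_opp |].
    apply (continuous_comp (fun r => - r) (pw s)).
    + apply (continuous_opp (V := R_NormedModule)), continuous_id.
    + apply continuous_pw_pos. lra.
  - apply filterlim_locally. intros eps. rewrite pw_0.
    (* This is eps^(1/s), the radius at which r^s reaches eps. *)
    set (d := exp (ln eps / s)).
    exists (mkposreal d (exp_pos _)). intros z Hz.
    unfold ball in *; simpl in *; unfold AbsRing_ball, abs, minus, plus, opp in *; simpl in *.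
    rewrite Ropp_0, Rplus_0_r in *. rewrite Rabs_pos_eq by apply pw_ge0.
    rewrite <- pw_abs. pose proof (Rabs_pos z) as Hz0.
    destruct (Req_dec (Rabs z) 0) as [E | E].
    + rewrite E, pw_0. apply eps.
    + rewrite pw_pos by lra. rewrite <- (exp_ln eps) by apply eps.
      apply exp_increasing. replace (ln eps) with (s * (ln eps / s)) by (field; lra).
      apply Rmult_lt_compat_l; auto. rewrite <- (ln_exp (ln eps / s)).
      apply ln_increasing; [lra | exact Hz].
  - now apply continuous_pw_pos.
Qed.

(** The right side is the tangent line of p ln x at x = p/d, where the slope is d. It lets an
    arbitrarily slow exponential absorb any power. *)
Lemma ln_le_linear (p d x : R) : 0 < p -> 0 < d -> 0 < x ->
  p * ln x <= d * x + (p * ln (p / d) - p).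
Proof.
  intros Hp Hd Hx.
  assert (H0 : 0 < p / d) by (apply Rdiv_lt_0_compat; auto).
  assert (H : ln (x / (p / d)) <= x / (p / d) - 1).
  { assert (Hy : 0 < x / (p / d)) by (apply Rdiv_lt_0_compat; auto).
    pose proof (exp_ineq1_le (ln (x / (p / d)))) as H. rewrite exp_ln in H; lra. }
  rewrite ln_div in H by auto.
  apply Rmult_le_compat_l with (r := p) in H; [| lra].
  replace (p * (x / (p / d) - 1)) with (d * x - p) in H by (field; lra). lra.
Qed.

Lemma pw_le_exp (s d : R) : 0 < s -> 0 < d ->
  exists C, 0 < C /\ forall r, 0 <= r -> pw s r <= C * exp (d * r).
Proof.
  intros Hs Hd. exists (exp (s * ln (s / d) - s)). split; [apply exp_pos |].
  intros r [Hr | <-].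
  - rewrite pw_pos, <- exp_plus by auto.
    pose proof (ln_le_linear s d r Hs Hd Hr) as H.
    destruct H as [H | H]; [left; apply exp_increasing | right; f_equal]; lra.
  - rewrite pw_0. left. apply Rmult_lt_0_compat; apply exp_pos.
Qed.

Lemma ex_RInt_cont (f : R -> R) (a b : R) : (forall x, continuous f x) -> ex_RInt f a b.
Proof. intros H. apply (ex_RInt_continuous (V := R_CompleteNormedModule)). auto. Qed.

Definition half_line_integral (f : R -> R) (L : R) : Prop :=
  is_lim (fun M => RInt f 0 M) p_infty L.

Lemma half_line_unique (f : R -> R) (L L' : R) :
  half_line_integral f L -> half_line_integral f L' -> L = L'.
Proof.
  intros H H'. apply is_lim_unique in H. apply is_lim_unique in H'.
  rewrite H in H'. now injection H'.
Qed.

Lemma half_line_lin (f g : R -> R) (a b F G : R) :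
  (forall x, continuous f x) -> (forall x, continuous g x) ->
  half_line_integral f F -> half_line_integral g G ->
  half_line_integral (fun r => a * f r + b * g r) (a * F + b * G).
Proof.
  intros Hf Hg HF HG.
  apply is_lim_ext with (f := fun M => a * RInt f 0 M + b * RInt g 0 M).
  - intros M. symmetry.
    rewrite (RInt_plus (V := R_CompleteNormedModule) (fun r => a * f r) (fun r => b * g r)).
    + unfold plus; simpl. f_equal.
      * apply (RInt_scal (V := R_CompleteNormedModule)). now apply ex_RInt_cont.
      * apply (RInt_scal (V := R_CompleteNormedModule)). now apply ex_RInt_cont.
    + apply (ex_RInt_scal (V := R_NormedModule)). now apply ex_RInt_cont.
    + apply (ex_RInt_scal (V := R_NormedModule)). now apply ex_RInt_cont.
  - apply (is_lim_plus' (fun M => a * RInt f 0 M) (fun M => b * RInt g 0 M)).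
    + apply (is_lim_scal_l _ a p_infty F HF).
    + apply (is_lim_scal_l _ b p_infty G HG).
Qed.

Lemma half_line_ext (f g : R -> R) (L : R) :
  (forall r, 0 < r -> f r = g r) -> half_line_integral f L -> half_line_integral g L.
Proof.
  intros E. apply is_lim_ext_loc. exists 0. intros M HM.
  apply RInt_ext. intros r Hr. rewrite Rmin_left in Hr by lra. apply E. lra.
Qed.

Lemma half_line_le (f g : R -> R) (F G : R) :
  (forall x, continuous f x) -> (forall x, continuous g x) ->
  (forall r, 0 < r -> f r <= g r) ->
  half_line_integral f F -> half_line_integral g G -> F <= G.
Proof.
  intros Hf Hg Hfg HF HG.
  refine (is_lim_le_loc _ _ p_infty F G _ HF HG).
  exists 0. intros M HM. apply RInt_le; try lra; try now apply ex_RInt_cont.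
  intros r Hr. apply Hfg. lra.
Qed.

Lemma half_line_ex_nonneg (f : R -> R) (K : R) :
  (forall x, continuous f x) -> (forall r, 0 <= r -> 0 <= f r) ->
  (forall M, 0 <= M -> RInt f 0 M <= K) -> exists L, half_line_integral f L.
Proof.
  intros Hf Hp HK.
  assert (Hmono : forall M N, 0 <= M <= N -> RInt f 0 M <= RInt f 0 N).
  { intros M N H.
    rewrite <- (RInt_Chasles (V := R_CompleteNormedModule) f 0 M N) by now apply ex_RInt_cont.
    unfold plus; simpl.
    assert (0 <= RInt f M N); [| lra].
    apply RInt_ge_0; [lra | now apply ex_RInt_cont |]. intros; apply Hp; lra. }
  destruct (completeness (fun v => exists M, 0 <= M /\ v = RInt f 0 M)) as [L [HL1 HL2]].
  - exists K. intros v [M [HM ->]]. auto.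
  - exists (RInt f 0 0), 0. split; [lra | auto].
  - exists L. apply is_lim_spec. intros eps.
    destruct (Classical_Prop.classic (exists M, 0 <= M /\ L - eps < RInt f 0 M)) as [[M [HM H]] | N].
    + exists M. intros N HN.
      assert (RInt f 0 N <= L) by (apply HL1; exists N; split; [lra | auto]).
      assert (RInt f 0 M <= RInt f 0 N) by (apply Hmono; lra).
      apply Rabs_lt_between. split; [lra |]. pose proof (cond_pos eps). lra.
    + exfalso. assert (L <= L - eps); [| pose proof (cond_pos eps); lra].
      apply HL2. intros v [M [HM ->]]. apply Rnot_lt_le. intros H. apply N. now exists M.
Qed.

Lemma RInt_exp_neg (d M : R) : 0 < d -> RInt (fun r => exp (- d * r)) 0 M = (1 - exp (- d * M)) / d.
Proof.
  intros Hd. apply is_RInt_unique.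
  replace ((1 - exp (- d * M)) / d)
    with (minus (- exp (- d * M) / d) (- exp (- d * 0) / d)).
  - apply (is_RInt_derive (V := R_CompleteNormedModule) (fun r => - exp (- d * r) / d)).
    + intros r _. auto_derive. lra. field. lra.
    + intros r _. apply (ex_derive_continuous (V := R_NormedModule)). auto_derive. auto.
  - unfold minus, plus, opp; simpl. rewrite Rmult_0_r, exp_0. field. lra.
Qed.

(** Adding the majorant [g] gives an integrand between 0 and 2 g, to which the monotone criterion
    applies; [g] is then subtracted. *)
Lemma half_line_ex_dominated (f : R -> R) (K d : R) : 0 < d ->
  (forall x, continuous f x) -> (forall r, 0 <= r -> Rabs (f r) <= K * exp (- d * r)) ->
  exists L, half_line_integral f L.
Proof.
  intros Hd Hf HK.
  set (g := fun r => K * exp (- d * r)).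
  assert (Hg : forall x, continuous g x).
  { intros x. apply (ex_derive_continuous (V := R_NormedModule)). unfold g. auto_derive. auto. }
  assert (HK0 : 0 <= K).
  { pose proof (HK 0 (Rle_refl 0)) as H. rewrite Rmult_0_r, exp_0 in H.
    pose proof (Rabs_pos (f 0)). lra. }
  assert (HgI : forall M, 0 <= M -> RInt g 0 M <= K / d).
  { intros M HM. unfold g.
    rewrite (RInt_scal (V := R_CompleteNormedModule) (fun r => exp (- d * r))).
    - rewrite RInt_exp_neg by auto. unfold scal; simpl; unfold mult; simpl.
      apply Rmult_le_compat_l; auto. unfold Rdiv.
      rewrite <- (Rmult_1_l (/ d)) at 2. apply Rmult_le_compat_r.
      + left. now apply Rinv_0_lt_compat.
      + pose proof (exp_pos (- d * M)). lra.
    - apply ex_RInt_cont. intros x. apply (ex_derive_continuous (V := R_NormedModule)).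
      auto_derive. auto. }
  assert (Hfg : forall x, continuous (fun r => f r + g r) x).
  { intros x. apply (continuous_plus (V := R_NormedModule)); auto. }
  destruct (half_line_ex_nonneg g (K / d)) as [G HG]; auto.
  { intros r _. unfold g. apply Rmult_le_pos; [auto | left; apply exp_pos]. }
  destruct (half_line_ex_nonneg (fun r => f r + g r) (2 * (K / d))) as [F HF]; auto.
  - intros r Hr. pose proof (HK r Hr) as H. apply Rabs_le_between in H. unfold g. lra.
  - intros M HM. apply Rle_trans with (RInt (fun r => g r + g r) 0 M).
    + apply RInt_le; auto; try now apply ex_RInt_cont.
      * apply ex_RInt_cont. intros x. apply (continuous_plus (V := R_NormedModule)); auto.
      * intros r Hr. pose proof (HK r ltac:(lra)) as H. apply Rabs_le_between in H. unfold g. lra.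
    + rewrite (RInt_plus (V := R_CompleteNormedModule)) by now apply ex_RInt_cont.
      unfold plus; simpl. pose proof (HgI M HM). lra.
  - exists (1 * F + -1 * G).
    apply half_line_ext with (f := fun r => 1 * (f r + g r) + -1 * g r).
    + intros; ring.
    + now apply half_line_lin.
Qed.

Lemma is_lim_scal_l_p_infty (f : R -> R) (c : R) (x : Rbar) : 0 < c ->
  is_lim f x p_infty -> is_lim (fun r => c * f r) x p_infty.
Proof.
  intros Hc H. apply (is_lim_scal_l _ c) in H.
  replace (Rbar_mult c p_infty) with p_infty in H; [exact H |]. simpl.
  destruct (Rle_dec 0 c) as [H' | H']; [| lra].
  destruct (Rle_lt_or_eq_dec 0 c H'); [auto | lra].
Qed.

Lemma is_lim_exp_neg (f : R -> R) : is_lim f p_infty p_infty ->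
  is_lim (fun r => exp (- f r)) p_infty 0.
Proof.
  intros H. apply (is_lim_comp exp (fun r => - f r) p_infty 0 m_infty).
  - apply is_lim_exp_m.
  - now apply (is_lim_opp f p_infty p_infty).
  - exists 0. intros; discriminate.
Qed.

(** * The Gamma function *)

(** The exponent is s rather than s - 1, so that s > 0 already gives a continuous integrand with no
    singularity at 0. *)
Definition gamma_integrand (s r : R) : R := pw s r * exp (- r).

Lemma continuous_gamma_integrand (s r : R) : 0 < s -> continuous (gamma_integrand s) r.
Proof.
  intros Hs. apply (continuous_mult (K := R_AbsRing)).
  - now apply continuous_pw.
  - apply (ex_derive_continuous (V := R_NormedModule)). auto_derive. auto.
Qed.

(* [gamma_plus s] is Gamma(s+1). *)
Definition gamma_plus (s : R) : R := real (Lim (fun M => RInt (gamma_integrand s) 0 M) p_infty).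

Lemma gamma_plus_correct (s : R) : 0 < s -> half_line_integral (gamma_integrand s) (gamma_plus s).
Proof.
  intros Hs.
  destruct (pw_le_exp s (1/2) Hs ltac:(lra)) as [C [HC HCr]].
  destruct (half_line_ex_dominated (gamma_integrand s) C (1 / 2)) as [L HL].
  - lra.
  - intros; now apply continuous_gamma_integrand.
  - intros r Hr. unfold gamma_integrand. rewrite Rabs_mult, Rabs_pos_eq by apply pw_ge0.
    rewrite Rabs_pos_eq by (left; apply exp_pos).
    replace (exp (- (1 / 2) * r)) with (exp (1 / 2 * r) * exp (- r))
      by (rewrite <- exp_plus; f_equal; field).
    rewrite <- Rmult_assoc. apply Rmult_le_compat_r; [left; apply exp_pos | auto].
  - unfold gamma_plus. replace (Lim _ p_infty) with (Finite L); [exact HL |].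
    symmetry. now apply is_lim_unique.
Qed.

Lemma gamma_plus_unique (s L : R) : 0 < s -> half_line_integral (gamma_integrand s) L -> gamma_plus s = L.
Proof. intros Hs H. eapply half_line_unique; [now apply gamma_plus_correct | exact H]. Qed.

Lemma gamma_integrand_vanish (s : R) : 0 < s -> is_lim (gamma_integrand s) p_infty 0.
Proof.
  intros Hs. destruct (pw_le_exp s (1/2) Hs ltac:(lra)) as [C [HC HCr]].
  apply is_lim_le_le_loc with (f := fun _ => 0) (g := fun r => C * exp (- (1 / 2 * r))).
  - exists 0. intros r Hr. unfold gamma_integrand. split.
    + apply Rmult_le_pos; [apply pw_ge0 | left; apply exp_pos].
    + replace (exp (- (1 / 2 * r))) with (exp (1 / 2 * r) * exp (- r))
        by (rewrite <- exp_plus; f_equal; field).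
      rewrite <- Rmult_assoc. apply Rmult_le_compat_r; [left; apply exp_pos | apply HCr; lra].
  - apply is_lim_const.
  - replace (Finite 0) with (Rbar_mult C 0) by (simpl; f_equal; ring).
    apply is_lim_scal_l, is_lim_exp_neg, is_lim_scal_l_p_infty; [lra | apply is_lim_id].
Qed.

(** At r = 0 the difference quotient has absolute value |h|^s, which tends to 0. Including this end
    point permits integration by parts on the closed interval [0, M]. *)
Lemma is_derive_pw_succ (s r : R) : 0 < s -> 0 <= r -> is_derive (pw (s + 1)) r ((s + 1) * pw s r).
Proof.
  intros Hs [Hr | <-].
  - replace ((s + 1) * pw s r) with ((s + 1) * pw (s + 1) r / r).
    + now apply is_derive_pw.
    + rewrite pw_succ, Rabs_pos_eq by lra. field. lra.
  - rewrite pw_0, Rmult_0_r. apply is_derive_Reals.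
    intros eps Heps.
    pose proof (continuous_pw s 0 Hs) as Hc.
    apply (proj1 (filterlim_locally _ _)) with (eps := mkposreal eps Heps) in Hc.
    destruct Hc as [d Hd]. exists d. intros h Hh Hhd.
    rewrite Rplus_0_l, pw_0, !Rminus_0_r, pw_succ.
    assert (B : ball 0 d h).
    { unfold ball; simpl; unfold AbsRing_ball, abs, minus, plus, opp; simpl.
      now rewrite Ropp_0, Rplus_0_r. }
    apply Hd in B. rewrite pw_0 in B.
    unfold ball in B; simpl in B; unfold AbsRing_ball, abs, minus, plus, opp in B; simpl in B.
    rewrite Ropp_0, Rplus_0_r in B. unfold Rdiv.
    rewrite !Rabs_mult, Rabs_Rabsolu, Rabs_inv.
    rewrite Rmult_assoc, Rinv_r, Rmult_1_r; [exact B |]. now apply Rabs_no_R0.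
Qed.

Lemma gamma_plus_succ (s : R) : 0 < s -> gamma_plus (s + 1) = (s + 1) * gamma_plus s.
Proof.
  intros Hs. apply gamma_plus_unique; [lra |].
  replace ((s + 1) * gamma_plus s) with (((s + 1) * gamma_plus s) - 0) by ring.
  apply is_lim_ext_loc
    with (f := fun M => (s + 1) * RInt (gamma_integrand s) 0 M - gamma_integrand (s + 1) M).
  - exists 0. intros M HM.
    assert (Hc : forall t, 0 < t -> forall x, continuous (gamma_integrand t) x)
      by (intros; now apply continuous_gamma_integrand).
    assert (H : is_RInt (fun r => (s + 1) * gamma_integrand s r - gamma_integrand (s + 1) r) 0 M
      (minus (gamma_integrand (s + 1) M) (gamma_integrand (s + 1) 0))).
    { apply (is_RInt_derive (V := R_CompleteNormedModule)).
      - intros r Hr. rewrite Rmin_left in Hr by lra.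
        unfold gamma_integrand.
        replace ((s + 1) * (pw s r * exp (- r)) - pw (s + 1) r * exp (- r))
          with ((s + 1) * pw s r * exp (- r) + pw (s + 1) r * (- exp (- r))) by ring.
        apply (is_derive_mult (pw (s + 1)) (fun r => exp (- r))).
        + apply is_derive_pw_succ; lra.
        + auto_derive. auto. ring.
        + intros; apply Rmult_comm.
      - intros r _. apply (continuous_minus (V := R_NormedModule)).
        + apply (continuous_scal_r (V := R_NormedModule)). now apply Hc.
        + apply Hc. lra. }
    apply (is_RInt_unique (V := R_CompleteNormedModule)) in H.
    rewrite (RInt_minus (V := R_CompleteNormedModule)) in H.
    + rewrite (RInt_scal (V := R_CompleteNormedModule)) in H by (apply ex_RInt_cont; auto).
      assert (E : gamma_integrand (s + 1) 0 = 0) by (unfold gamma_integrand; rewrite pw_0; ring).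
      rewrite E in H. unfold minus, plus, opp, scal in H; simpl in H; unfold mult in H; simpl in H.
      lra.
    + apply (ex_RInt_scal (V := R_NormedModule)). apply ex_RInt_cont; auto.
    + apply ex_RInt_cont. apply Hc. lra.
  - apply is_lim_minus'.
    + apply (is_lim_scal_l _ (s + 1) p_infty (gamma_plus s)). now apply gamma_plus_correct.
    + apply gamma_integrand_vanish. lra.
Qed.

Lemma gamma_plus_1 : gamma_plus 1 = 1.
Proof.
  apply gamma_plus_unique; [lra |].
  apply is_lim_ext_loc with (f := fun M => 1 - exp (- M) - gamma_integrand 1 M).
  - exists 0. intros M HM. unfold gamma_integrand. rewrite pw_1, Rabs_pos_eq by lra.
    symmetry. rewrite RInt_ext with (g := fun r => r * exp (- r)).
    + apply (is_RInt_unique (V := R_CompleteNormedModule)).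
      replace (1 - exp (- M) - M * exp (- M))
        with (minus (- exp (- M) - M * exp (- M)) (- exp (- 0) - 0 * exp (- 0))).
      * apply (is_RInt_derive (V := R_CompleteNormedModule) (fun r => - exp (- r) - r * exp (- r))).
        -- intros r _. auto_derive. auto. ring.
        -- intros r _. apply (ex_derive_continuous (V := R_NormedModule)). auto_derive. auto.
      * unfold minus, plus, opp; simpl. rewrite Ropp_0, exp_0. ring.
    + intros r Hr. rewrite Rmin_left in Hr by lra. rewrite pw_1, Rabs_pos_eq by lra. auto.
  - replace (Finite 1) with (Finite (1 - 0 - 0)) by (f_equal; ring).
    apply is_lim_minus'; [apply is_lim_minus' |].
    + apply is_lim_const.
    + apply is_lim_exp_neg, is_lim_id.
    + apply gamma_integrand_vanish. lra.
Qed.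

Lemma gamma_plus_fact (n : nat) : gamma_plus (INR (S n)) = INR (fact (S n)).
Proof.
  induction n as [|n IH].
  - simpl. apply gamma_plus_1.
  - rewrite S_INR, gamma_plus_succ, IH by (apply lt_0_INR; lia).
    rewrite (fact_simpl (S n)), mult_INR, (S_INR (S n)). ring.
Qed.

(** * Growth of Gamma(n + s + 1) *)

Lemma exp_le (a b : R) : a <= b -> exp a <= exp b.
Proof. intros [H | ->]; [left; now apply exp_increasing | lra]. Qed.

Lemma ln_le_sub_one (x : R) : 0 < x -> ln x <= x - 1.
Proof. intros H. pose proof (exp_ineq1_le (ln x)) as E. rewrite exp_ln in E; lra. Qed.

(** The convex function r^(-q) lies above its tangent line at c. *)
Lemma pw_neg_tangent (q c r : R) : 0 <= q -> 0 < c -> 0 < r ->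
  pw (- q) c * (1 + q - q * r / c) <= pw (- q) r.
Proof.
  intros Hq Hc Hr. rewrite !pw_pos by auto.
  assert (Hx : 0 < r / c) by now apply Rdiv_lt_0_compat.
  replace (- q * ln r) with (- q * ln c + - q * ln (r / c)) by (rewrite ln_div by auto; ring).
  rewrite exp_plus. apply Rmult_le_compat_l; [left; apply exp_pos |].
  pose proof (exp_ineq1_le (- q * ln (r / c))). pose proof (ln_le_sub_one _ Hx).
  replace (q * r / c) with (q * (r / c)) by (field; lra). nra.
Qed.

(** The concave function r^s lies below its tangent line at c. *)
Lemma pw_young (s c r : R) : 0 <= s <= 1 -> 0 < c -> 0 < r ->
  pw s r <= pw s c * (1 - s + s * r / c).
Proof.
  intros Hs Hc Hr. rewrite !pw_pos by auto.
  assert (Hx : 0 < r / c) by now apply Rdiv_lt_0_compat.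
  replace (s * ln r) with (s * ln c + s * ln (r / c)) by (rewrite ln_div by auto; ring).
  rewrite exp_plus. apply Rmult_le_compat_l; [left; apply exp_pos |].
  replace (s * r / c) with (s * (r / c)) by (field; lra).
  set (x := r / c) in *. set (m := 1 - s + s * x).
  assert (Hm : 0 < m) by (unfold m; destruct (Req_dec s 0) as [-> | H]; [lra | nra]).
  rewrite <- (exp_ln m) by auto. apply exp_le.
  (* Weighted arithmetic-geometric mean inequality x^s <= m: with weights s and 1 - s, the right
     sides of [H1] and [H2] add up to 0. *)
  assert (H1 : ln (x / m) <= x / m - 1) by (apply ln_le_sub_one; now apply Rdiv_lt_0_compat).
  assert (H2 : ln (1 / m) <= 1 / m - 1) by (apply ln_le_sub_one; apply Rdiv_lt_0_compat; lra).
  rewrite ln_div in H1, H2 by lra. rewrite ln_1 in H2.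
  assert (H3 : s * (x / m - 1) + (1 - s) * (1 / m - 1) = 0) by (unfold m in *; field; lra).
  nra.
Qed.

(** Integrates the tangent bound for r^s against r^N exp(-r). The tangent point N + 1 is the mean of
    this Gamma weight, so the linear part contributes exactly its value there. *)
Lemma gamma_plus_upper (n : nat) (s : R) : 0 < s <= 1 ->
  gamma_plus (INR (S n) + s) <= pw s (INR (S n) + 1) * INR (fact (S n)).
Proof.
  intros Hs. set (N := INR (S n)).
  assert (HN : 0 < N) by (apply lt_0_INR; lia).
  assert (Hc : forall t, 0 < t -> forall x, continuous (gamma_integrand t) x)
    by (intros; now apply continuous_gamma_integrand).
  replace (pw s (N + 1) * INR (fact (S n)))
    with (pw s (N + 1) * (1 - s) * gamma_plus N
          + pw s (N + 1) * s / (N + 1) * gamma_plus (N + 1)).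
  - eapply half_line_le with (f := gamma_integrand (N + s));
      [ apply Hc; lra | | | apply gamma_plus_correct; lra
      | apply (half_line_lin (gamma_integrand N) (gamma_integrand (N + 1)));
        first [apply gamma_plus_correct; lra | apply Hc; lra] ].
    + intros x. apply (continuous_plus (V := R_NormedModule));
        apply (continuous_scal_r (V := R_NormedModule)); apply Hc; lra.
    + intros r Hr. unfold gamma_integrand. rewrite pw_succ, pw_plus, Rabs_pos_eq by lra.
      pose proof (pw_young s (N + 1) r ltac:(lra) ltac:(lra) Hr) as H.
      pose proof (pw_ge0 N r). pose proof (exp_pos (- r)).
      apply Rle_trans with (pw N r * (pw s (N + 1) * (1 - s + s * r / (N + 1))) * exp (- r)).
      * apply Rmult_le_compat_r; [lra |]. now apply Rmult_le_compat_l.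
      * right. field. lra.
  - rewrite gamma_plus_succ by auto.
    assert (E : gamma_plus N = INR (fact (S n))) by apply gamma_plus_fact.
    rewrite E. field. lra.
Qed.

(** Writes r^(N+s) as r^(N+1) r^(-q) with q = 1 - s and uses the convex tangent at N + 2, the mean
    of the weight r^(N+1) exp(-r). *)
Lemma gamma_plus_lower (n : nat) (s : R) : 0 < s <= 1 ->
  pw (- (1 - s)) (INR (S n) + 2) * ((INR (S n) + 1) * INR (fact (S n)))
  <= gamma_plus (INR (S n) + s).
Proof.
  intros Hs. set (N := INR (S n)). set (q := 1 - s).
  assert (HN : 0 < N) by (apply lt_0_INR; lia).
  assert (Hc : forall t, 0 < t -> forall x, continuous (gamma_integrand t) x)
    by (intros; now apply continuous_gamma_integrand).
  replace (pw (- q) (N + 2) * ((N + 1) * INR (fact (S n))))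
    with (pw (- q) (N + 2) * (1 + q) * gamma_plus (N + 1)
          + - (pw (- q) (N + 2) * q / (N + 2)) * gamma_plus (N + 1 + 1)).
  - eapply half_line_le with (g := gamma_integrand (N + s));
      [ | apply Hc; lra | 
      | apply (half_line_lin (gamma_integrand (N + 1)) (gamma_integrand (N + 1 + 1)));
        first [apply gamma_plus_correct; lra | apply Hc; lra]
      | apply gamma_plus_correct; lra ].
    + intros x. apply (continuous_plus (V := R_NormedModule));
        apply (continuous_scal_r (V := R_NormedModule)); apply Hc; lra.
    + intros r Hr. unfold gamma_integrand.
      replace (N + s) with ((N + 1) + - q) by (unfold q; ring).
      rewrite (pw_plus (N + 1) (- q)), (pw_succ (N + 1)), (Rabs_pos_eq r) by lra.
      pose proof (pw_neg_tangent q (N + 2) r ltac:(unfold q; lra) ltac:(lra) Hr) as H.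
      pose proof (pw_ge0 (N + 1) r). pose proof (exp_pos (- r)).
      apply Rle_trans with
        (pw (N + 1) r * (pw (- q) (N + 2) * (1 + q - q * r / (N + 2))) * exp (- r)).
      * right. field. lra.
      * apply Rmult_le_compat_r; [lra |]. now apply Rmult_le_compat_l.
  - rewrite (gamma_plus_succ (N + 1)), (gamma_plus_succ N) by lra.
    assert (E : gamma_plus N = INR (fact (S n))) by apply gamma_plus_fact.
    rewrite E. field. lra.
Qed.

Definition gamma_ratio (s : R) (n : nat) : R :=
  gamma_plus (INR n + s) / (INR (fact n) * pw s (INR n)).

Lemma gamma_ratio_bound (n : nat) (s : R) : 0 < s <= 1 ->
  1 - / INR (S n) <= gamma_ratio s (S n) <= 1 + / INR (S n).
Proof.
  intros Hs. unfold gamma_ratio.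
  pose proof (gamma_plus_upper n s Hs) as HU. pose proof (gamma_plus_lower n s Hs) as HL.
  assert (HN : 0 < INR (S n)) by (apply lt_0_INR; lia).
  assert (HF : 0 < INR (fact (S n))) by apply INR_fact_lt_0.
  set (N := INR (S n)) in *. set (F := INR (fact (S n))) in *.
  rewrite !pw_pos in * by lra. pose proof (exp_pos (s * ln N)) as HE.
  assert (HFE : 0 < F * exp (s * ln N)) by now apply Rmult_lt_0_compat.
  assert (L1 : ln N < ln (N + 1)) by (apply ln_increasing; lra).
  assert (L2 : ln N < ln (N + 2)) by (apply ln_increasing; lra).
  split; apply Rmult_le_reg_r with (F * exp (s * ln N)); auto;
    unfold Rdiv; rewrite Rmult_assoc, Rinv_l, Rmult_1_r by lra.
  - eapply Rle_trans; [| exact HL].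
    assert (H : exp (s * ln N) <= exp (- (1 - s) * ln (N + 2)) * (N + 2)).
    { rewrite <- (exp_ln (N + 2)) at 2 by lra. rewrite <- exp_plus. apply exp_le. nra. }
    apply Rle_trans with ((N + 1) / (N + 2) * (F * exp (s * ln N))).
    + apply Rmult_le_compat_r; [lra |].
      replace ((N + 1) / (N + 2)) with (1 - / (N + 2)) by (field; lra).
      assert (/ (N + 2) <= / N) by (apply Rinv_le_contravar; lra). lra.
    + replace (exp (- (1 - s) * ln (N + 2)) * ((N + 1) * F))
        with ((N + 1) / (N + 2) * (F * (exp (- (1 - s) * ln (N + 2)) * (N + 2)))) by (field; lra).
      apply Rmult_le_compat_l; [left; apply Rdiv_lt_0_compat; lra |].
      apply Rmult_le_compat_l; lra.
  - eapply Rle_trans; [exact HU |].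
    assert (H : exp (s * ln (N + 1)) * N <= (N + 1) * exp (s * ln N)).
    { rewrite <- (exp_ln N) at 2 by lra. rewrite <- (exp_ln (N + 1)) at 2 by lra.
      rewrite <- !exp_plus. apply exp_le. nra. }
    apply Rmult_le_reg_r with N; auto.
    replace ((1 + / N) * (F * exp (s * ln N)) * N) with (F * ((N + 1) * exp (s * ln N)))
      by (field; lra).
    replace (exp (s * ln (N + 1)) * F * N) with (F * (exp (s * ln (N + 1)) * N)) by ring.
    apply Rmult_le_compat_l; lra.
Qed.

(** The tangent bounds cover 0 < s <= 1. Larger s follow by induction on an integer bound, as
    passing from s - 1 to s multiplies the ratio by 1 + s/n. *)
Lemma gamma_ratio_lim (s : R) : 0 < s -> is_lim_seq (gamma_ratio s) 1.
Proof.
  intros Hs.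
  assert (H : forall k s, 0 < s <= INR (S k) -> is_lim_seq (gamma_ratio s) 1).
  2 : { destruct (INR_unbounded s) as [k Hk]. apply (H k). rewrite S_INR. lra. }
  clear s Hs. induction k as [|k IH]; intros s Hs.
  - apply is_lim_seq_incr_1.
    apply is_lim_seq_le_le with (u := fun n => 1 - / INR (S n)) (w := fun n => 1 + / INR (S n)).
    + intros n. apply gamma_ratio_bound. simpl in Hs. lra.
    + replace (Finite 1) with (Finite (1 - 0)) by (f_equal; ring).
      apply is_lim_seq_minus'; [apply is_lim_seq_const |].
      apply (is_lim_seq_incr_1 (fun n => / INR n)), is_lim_seq_inv_INR.
    + replace (Finite 1) with (Finite (1 + 0)) by (f_equal; ring).
      apply is_lim_seq_plus'; [apply is_lim_seq_const |].
      apply (is_lim_seq_incr_1 (fun n => / INR n)), is_lim_seq_inv_INR.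
  - destruct (Rle_dec s (INR (S k))) as [H | H]; [apply IH; lra |].
    rewrite S_INR in Hs.
    assert (H1 : 1 < s) by (pose proof (pos_INR k); rewrite S_INR in H; lra).
    apply is_lim_seq_ext_loc with (u := fun n => (1 + s * / INR n) * gamma_ratio (s - 1) n).
    + exists 1%nat. intros n Hn. assert (HN : 0 < INR n) by (apply lt_0_INR; lia).
      unfold gamma_ratio. replace s with ((s - 1) + 1) at 4 5 by ring.
      rewrite pw_succ, <- Rplus_assoc, gamma_plus_succ, Rabs_pos_eq by lra.
      assert (pw (s - 1) (INR n) <> 0) by (rewrite pw_pos by auto; pose proof (exp_pos ((s - 1) * ln (INR n))); lra).
      pose proof (INR_fact_neq_0 n). field. repeat split; auto; lra.
    + replace (Finite 1) with (Finite ((1 + s * 0) * 1)) by (f_equal; ring).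
      apply is_lim_seq_mult'; [| apply IH; lra].
      apply is_lim_seq_plus'; [apply is_lim_seq_const |].
      apply (is_lim_seq_scal_l _ s 0), is_lim_seq_inv_INR.
Qed.

(** * Gauss' limit and the reflection formula *)

Definition gauss (z : R) (n : nat) : R := poch_prod z n / (INR (fact n) * rpow (INR n) z).

Lemma rpow_INR (n : nat) (z : R) : rpow (INR n) z = pw z (INR n).
Proof. unfold pw. now rewrite Rabs_pos_eq by apply pos_INR. Qed.

Lemma poch_prod_gamma_plus (s : R) (n : nat) : 0 < s ->
  poch_prod s n * gamma_plus s = s * gamma_plus (INR n + s).
Proof.
  intros Hs. induction n as [|n IH].
  - simpl. now rewrite Rplus_0_l.
  - cbn [poch_prod]. rewrite S_INR.
    replace (INR n + 1 + s) with (INR n + s + 1) by ring.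
    rewrite gamma_plus_succ by (pose proof (pos_INR n); lra).
    transitivity ((poch_prod s n * gamma_plus s) * (s + (INR n + 1))); [ring |].
    rewrite IH. ring.
Qed.

(** The limit is 1/Gamma(s). Nonvanishing comes from the same identity: if [gamma_plus s] were 0,
    [gamma_ratio s] would vanish identically and could not tend to 1. *)
Lemma gauss_lim_pos (s : R) : 0 < s ->
  gamma_plus s <> 0 /\ is_lim_seq (gauss s) (s / gamma_plus s).
Proof.
  intros Hs. pose proof (gamma_ratio_lim s Hs) as HL.
  assert (E : forall n, gauss s n * gamma_plus s = s * gamma_ratio s n).
  { intros n. unfold gauss, gamma_ratio. rewrite rpow_INR. unfold Rdiv.
    rewrite Rmult_assoc, (Rmult_comm (/ _)), <- Rmult_assoc, poch_prod_gamma_plus by auto. ring. }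
  assert (HN : gamma_plus s <> 0).
  { intros Z. assert (H : is_lim_seq (gamma_ratio s) 0).
    - apply is_lim_seq_ext with (u := fun _ => 0); [| apply is_lim_seq_const].
      intros n. specialize (E n). rewrite Z, Rmult_0_r in E. 
      symmetry in E. apply Rmult_integral in E. destruct E; lra.
    - apply is_lim_seq_unique in H. apply is_lim_seq_unique in HL.
      rewrite H in HL. injection HL. lra. }
  split; auto.
  apply is_lim_seq_ext with (u := fun n => s / gamma_plus s * gamma_ratio s n).
  - intros n. transitivity ((s * gamma_ratio s n) / gamma_plus s); [field; auto |].
    rewrite <- E. field; auto.
  - replace (Finite (s / gamma_plus s)) with (Rbar_mult (s / gamma_plus s) 1)
      by (simpl; f_equal; ring).
    now apply is_lim_seq_scal_l.
Qed.

(** Pairs the factors k - s and k + s; the pair k = 0 gives -s^2. *)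
Lemma poch_prod_sine_prod (s : R) (n : nat) :
  poch_prod (- s) n * poch_prod s n = - s ^ 2 * INR (fact n) ^ 2 * sine_prod s n.
Proof.
  induction n as [|n IH].
  - simpl. ring.
  - cbn [poch_prod sine_prod].
    transitivity ((poch_prod (- s) n * poch_prod s n) * (INR (S n) ^ 2 - s ^ 2)); [ring |].
    rewrite IH, fact_simpl, mult_INR. field. apply not_0_INR; lia.
Qed.

(** In the product of [gauss (- s)] and [gauss s] the powers of n cancel and -s^2 [sine_prod s n]
    remains. The division is by [gauss s], never zero for n >= 1, so integer s are not
    exceptional. *)
Lemma gauss_lim_neg (s : R) : 0 < s ->
  is_lim_seq (gauss (- s)) (- (sin (PI * s) * gamma_plus s / PI)).
Proof.
  intros Hs. destruct (gauss_lim_pos s Hs) as [HN HL].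
  assert (HP := PI_RGT_0).
  assert (Hne : forall n, poch_prod s n <> 0).
  { intros n Z. induction n as [|n IH]; simpl in Z; [lra |].
    apply Rmult_integral in Z. destruct Z as [Z | Z]; [auto |].
    fold (INR (S n)) in Z. pose proof (pos_INR (S n)). simpl in *. lra. }
  apply is_lim_seq_ext_loc with (u := fun n => - s ^ 2 * sine_prod s n * / gauss s n).
  - exists 1%nat. intros n Hn. assert (HNn : 0 < INR n) by (apply lt_0_INR; lia).
    unfold gauss. rewrite !rpow_INR.
    assert (E : pw (- s) (INR n) = / pw s (INR n)).
    { rewrite !pw_pos by auto. rewrite <- exp_Ropp. f_equal. ring. }
    assert (H0 : pw s (INR n) <> 0)
      by (rewrite pw_pos by auto; pose proof (exp_pos (s * ln (INR n))); lra).
    rewrite E. pose proof (INR_fact_neq_0 n). pose proof (poch_prod_sine_prod s n) as H1.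
    replace (poch_prod (- s) n)
      with ((- s ^ 2 * INR (fact n) ^ 2 * sine_prod s n) / poch_prod s n)
      by (rewrite <- H1; field; auto).
    field. repeat split; auto.
  - replace (Finite (- (sin (PI * s) * gamma_plus s / PI)))
      with (Finite (- s ^ 2 * (sin (PI * s) / (PI * s)) * / (s / gamma_plus s)))
      by (f_equal; field; repeat split; auto; lra).
    apply is_lim_seq_mult'.
    + apply (is_lim_seq_scal_l _ (- s ^ 2) (sin (PI * s) / (PI * s))).
      apply is_lim_seq_sine_prod. lra.
    + apply (is_lim_seq_inv _ (s / gamma_plus s)); auto. intros Z. injection Z.
      intros Z'. unfold Rdiv in Z'. apply Rmult_integral in Z'. destruct Z' as [Z' | Z']; [lra |].
      now apply Rinv_neq_0_compat in Z'.
Qed.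

(** Shifting -s to 1 - s inside Gauss' product costs the factor -(1 + (1 - s)/n)/s. The formula
    includes integers s, where both sides are 0. *)
Lemma rgamma_one_minus (s : R) : 0 < s ->
  rgamma (1 - s) = sin (PI * s) * gamma_plus s / (PI * s).
Proof.
  intros Hs. assert (HP := PI_RGT_0).
  unfold rgamma. change (fun n => _) with (gauss (1 - s)).
  assert (H : is_lim_seq (gauss (1 - s)) (sin (PI * s) * gamma_plus s / (PI * s))).
  - apply is_lim_seq_ext_loc
      with (u := fun n => - / s * (1 + (1 - s) * / INR n) * gauss (- s) n).
    + exists 1%nat. intros n Hn. assert (HNn : 0 < INR n) by (apply lt_0_INR; lia).
      assert (E : poch_prod (1 - s) n * - s = poch_prod (- s) n * (INR n + (1 - s))).
      { clear Hn HNn. induction n as [|n IH]; [simpl; ring |].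
        cbn [poch_prod]. rewrite S_INR.
        transitivity ((poch_prod (1 - s) n * - s) * (1 - s + (INR n + 1))); [ring |].
        rewrite IH. ring. }
      unfold gauss. rewrite !rpow_INR. replace (1 - s) with (- s + 1) at 3 by ring.
      rewrite pw_succ, Rabs_pos_eq by lra.
      assert (H0 : pw (- s) (INR n) <> 0)
        by (rewrite pw_pos by auto; pose proof (exp_pos (- s * ln (INR n))); lra).
      replace (poch_prod (1 - s) n) with (poch_prod (- s) n * (INR n + (1 - s)) * - / s)
        by (rewrite <- E; field; lra).
      pose proof (INR_fact_neq_0 n). field. repeat split; auto; lra.
    + replace (Finite (sin (PI * s) * gamma_plus s / (PI * s)))
        with (Finite (- / s * (1 + (1 - s) * 0) * - (sin (PI * s) * gamma_plus s / PI)))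
        by (f_equal; field; lra).
      apply is_lim_seq_mult'; [| now apply gauss_lim_neg].
      apply (is_lim_seq_scal_l _ (- / s) (1 + (1 - s) * 0)).
      apply is_lim_seq_plus'; [apply is_lim_seq_const |].
      apply (is_lim_seq_scal_l _ (1 - s) 0), is_lim_seq_inv_INR.
  - apply is_lim_seq_unique in H. now rewrite H.
Qed.

(** * Rotation of the contour *)

(* With beta = r e^(i th), the integrand exp(-i y beta - eta (-i beta)^a) d beta equals
   exp(ray_re + i ray_im) dr on the ray of angle th. *)
Definition ray_re (a eta y r th : R) : R :=
  y * r * sin th - eta * pw a r * cos (a * (th - PI / 2)).
Definition ray_im (a eta y r th : R) : R :=
  th - y * r * cos th - eta * pw a r * sin (a * (th - PI / 2)).
(** Real part of exp(i psi) times the integrand on the ray; the Jacobian exp(i th) is already in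
    [ray_im]. The phases 0 and -pi/2 select real and imaginary parts, and adding pi/2 to psi
    multiplies by i. *)
Definition ray (a eta y psi r th : R) : R :=
  exp (ray_re a eta y r th) * cos (ray_im a eta y r th + psi).
Definition ray_dth (a eta y psi r th : R) : R :=
  exp (ray_re a eta y r th) *
  ((y * r * cos th + eta * pw a r * a * sin (a * (th - PI / 2))) * cos (ray_im a eta y r th + psi)
   - (1 + y * r * sin th - eta * pw a r * a * cos (a * (th - PI / 2)))
     * sin (ray_im a eta y r th + psi)).

Lemma is_derive_ray_th (a eta y psi r th : R) :
  is_derive (fun th => ray a eta y psi r th) th (ray_dth a eta y psi r th).
Proof.
  unfold ray, ray_dth, ray_re, ray_im. auto_derive; [auto |]. unfold Rminus. ring.
Qed.

(* The Cauchy-Riemann equations in polar coordinates: the angular derivative of the integrand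
   is a radial derivative. *)
Lemma is_derive_ray_r (a eta y psi r th : R) : 0 < r ->
  is_derive (fun r => r * ray a eta y (psi + PI / 2) r th) r (ray_dth a eta y psi r th).
Proof.
  intros Hr. pose proof (is_derive_pw a r Hr) as Hd.
  assert (E : forall v, cos (v + (psi + PI / 2)) = - sin (v + psi)).
  { intros v. rewrite <- Rplus_assoc, cos_plus, cos_PI2, sin_PI2. ring. }
  apply is_derive_ext with (f := fun r => - (r * (exp (ray_re a eta y r th)
    * sin (ray_im a eta y r th + psi)))).
  { intros t. unfold ray. rewrite E. apply Rminus_diag_uniq. ring. }
  unfold ray_dth, ray_re, ray_im. auto_derive.
  - repeat split; auto; now exists (a * pw a r / r).
  - replace (Derive (fun x => pw a x) r) with (a * pw a r / r)
      by (symmetry; now apply is_derive_unique).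
    unfold Rminus. field. lra.
Qed.

Lemma continuity_2d_ray_dth (a eta y psi th r : R) : 0 < r ->
  continuity_2d_pt (fun th r => ray_dth a eta y psi r th) th r.
Proof.
  intros Hr.
  assert (Hp : continuity_2d_pt (fun _ r => pw a r) th r).
  { apply (continuity_1d_2d_pt_comp (pw a) (fun _ r => r)).
    - apply continuity_pt_filterlim, continuous_pw_pos, Hr.
    - apply continuity_2d_pt_id2. }
  assert (Hcos : forall x, continuity_pt cos x) by (intros; apply continuity_cos).
  assert (Hsin : forall x, continuity_pt sin x) by (intros; apply continuity_sin).
  assert (Hexp : forall x, continuity_pt exp x)
    by (intros; apply derivable_continuous_pt, derivable_pt_exp).
  unfold ray_dth, ray_re, ray_im.
  repeat first
    [ exact Hp
    | apply continuity_2d_pt_const | apply continuity_2d_pt_id1 | apply continuity_2d_pt_id2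
    | apply continuity_2d_pt_plus | apply continuity_2d_pt_opp | apply continuity_2d_pt_mult
    | apply (continuity_1d_2d_pt_comp exp); [apply Hexp |]
    | apply (continuity_1d_2d_pt_comp cos); [apply Hcos |]
    | apply (continuity_1d_2d_pt_comp sin); [apply Hsin |] ].
Qed.

Lemma continuous_comp_R (f g : R -> R) (x : R) :
  continuous f x -> ex_derive g (f x) -> continuous (fun t => g (f t)) x.
Proof.
  intros Hf Hg. apply (continuous_comp f g); auto.
  now apply (ex_derive_continuous (V := R_NormedModule)).
Qed.

Lemma continuous_ray (a eta y psi th r : R) : 0 < a ->
  continuous (fun r => ray a eta y psi r th) r.
Proof.
  intros Ha. pose proof (continuous_pw a r Ha) as Hp.
  assert (Hp2 : forall c, continuous (fun r => eta * pw a r * c) r).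
  { intros c. apply (continuous_scal_l (V := R_NormedModule) (fun r => eta * pw a r)).
    now apply (continuous_scal_r (V := R_NormedModule)). }
  unfold ray, ray_re, ray_im. apply (continuous_mult (K := R_AbsRing)).
  - apply (continuous_comp_R _ exp); [| auto_derive; auto].
    apply (continuous_minus (V := R_NormedModule)); [| apply Hp2].
    apply (ex_derive_continuous (V := R_NormedModule)). auto_derive. auto.
  - apply (continuous_comp_R _ cos); [| auto_derive; auto].
    apply (continuous_plus (V := R_NormedModule)); [| apply continuous_const].
    apply (continuous_minus (V := R_NormedModule)); [| apply Hp2].
    apply (ex_derive_continuous (V := R_NormedModule)). auto_derive. auto.
Qed.

(** The angular derivative is a radial one, so its integral reduces to the two end points. The lower
    end stays at e > 0 because r^a has no derivative at 0 when a < 1. *)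
Lemma is_derive_ray_integral (a eta y psi e M th : R) : 0 < a -> 0 < e <= M ->
  is_derive (fun th => RInt (fun r => ray a eta y psi r th) e M) th
    (M * ray a eta y (psi + PI / 2) M th - e * ray a eta y (psi + PI / 2) e th).
Proof.
  intros Ha He.
  assert (HD : forall th r, Derive (fun u => ray a eta y psi r u) th = ray_dth a eta y psi r th)
    by (intros; apply is_derive_unique, is_derive_ray_th).
  replace (M * ray a eta y (psi + PI / 2) M th - e * ray a eta y (psi + PI / 2) e th)
    with (RInt (fun r => Derive (fun u => ray a eta y psi r u) th) e M).
  - apply (is_derive_RInt_param (fun th r => ray a eta y psi r th)).
    + apply filter_forall. intros t r _. eexists. apply is_derive_ray_th.
    + intros r Hr. rewrite Rmin_left in Hr by lra.
      apply continuity_2d_pt_ext with (f := fun th r => ray_dth a eta y psi r th).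
      * intros; symmetry; apply HD.
      * apply continuity_2d_ray_dth. lra.
    + apply filter_forall. intros t. apply ex_RInt_cont. intros; now apply continuous_ray.
  - rewrite RInt_ext with (g := fun r => ray_dth a eta y psi r th) by (intros; apply HD).
    apply (is_RInt_unique (V := R_CompleteNormedModule)).
    apply (is_RInt_derive (V := R_CompleteNormedModule)
             (fun r => r * ray a eta y (psi + PI / 2) r th)).
    + intros r Hr. rewrite Rmin_left in Hr by lra. apply is_derive_ray_r. lra.
    + intros r Hr. rewrite Rmin_left in Hr by lra.
      apply (continuous_comp_2 (fun _ => th) (fun r => r) (fun th r => ray_dth a eta y psi r th)).
      * apply continuous_const.
      * apply continuous_id.
      * apply (proj1 (continuity_2d_pt_filterlim (fun th r => ray_dth a eta y psi r th) th r)).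
        apply continuity_2d_ray_dth. lra.
Qed.

Lemma is_lim_pw_p_infty (a : R) : 0 < a -> is_lim (pw a) p_infty p_infty.
Proof.
  intros Ha. apply is_lim_ext_loc with (f := fun r => exp (a * ln r)).
  - exists 0. intros r Hr. symmetry. now apply pw_pos.
  - apply (is_lim_comp exp (fun r => a * ln r) p_infty p_infty p_infty).
    + apply is_lim_exp_p.
    + apply is_lim_scal_l_p_infty; [auto | apply is_lim_ln_p].
    + exists 0. intros; discriminate.
Qed.

Lemma is_lim_mul_exp_pw (a c : R) : 0 < a -> 0 < c ->
  is_lim (fun r => r * exp (- (c * pw a r))) p_infty 0.
Proof.
  (* [C] is the constant of [ln_le_linear] for ln r = (1/a) ln(r^a) with slope c/2: half of the
     decay absorbs the factor r. *)
  intros Ha Hc. set (C := / a * ln (/ a / (c / 2)) - / a).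
  apply is_lim_le_le_loc with (f := fun _ => 0) (g := fun r => exp C * exp (- (c / 2 * pw a r))).
  - exists 0. intros r Hr. split.
    + apply Rmult_le_pos; [lra | left; apply exp_pos].
    + rewrite <- (exp_ln r) at 1 by auto. rewrite <- !exp_plus. apply exp_le.
      assert (HX : 0 < pw a r) by (rewrite pw_pos by auto; apply exp_pos).
      pose proof (ln_le_linear (/ a) (c / 2) (pw a r) (Rinv_0_lt_compat _ Ha) ltac:(lra) HX) as H.
      fold C in H. rewrite (pw_pos a r Hr), ln_exp in H.
      rewrite (pw_pos a r Hr). rewrite <- Rmult_assoc, Rinv_l, Rmult_1_l in H by lra. lra.
  - apply is_lim_const.
  - replace (Finite 0) with (Rbar_mult (exp C) 0) by (simpl; f_equal; ring).
    apply is_lim_scal_l, is_lim_exp_neg, is_lim_scal_l_p_infty; [lra |].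
    now apply is_lim_pw_p_infty.
Qed.

Section Rotation.

Variables (a eta y : R).
Hypotheses (Ha : 0 < a <= 1 / 2) (Heta : 0 < eta) (Hy : 0 < y).

(** The condition a <= 1/2 keeps the argument of (-i beta)^a within a quarter turn, hence its cosine
    nonnegative, during the whole rotation. *)
Lemma ray_angle_bounds (th : R) : - (PI / 2) <= th <= 0 ->
  0 <= - (a * (th - PI / 2)) <= PI / 2.
Proof. assert (HP := PI_RGT_0). intros H. split; nra. Qed.

Lemma ray_re_le_0 (r th : R) : 0 <= r -> - (PI / 2) <= th <= 0 -> ray_re a eta y r th <= 0.
Proof.
  intros Hr Hth. assert (HP := PI_RGT_0). unfold ray_re.
  pose proof (ray_angle_bounds th Hth) as Hb.
  assert (Hs : 0 <= - sin th) by (rewrite <- sin_neg; apply sin_ge_0; lra).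
  assert (Hc : 0 <= cos (a * (th - PI / 2))) by (apply cos_ge_0; lra).
  assert (H1 : 0 <= y * r * - sin th) by (apply Rmult_le_pos; [apply Rmult_le_pos |]; lra).
  assert (H2 : 0 <= eta * pw a r * cos (a * (th - PI / 2))).
  { apply Rmult_le_pos; auto. apply Rmult_le_pos; [lra | apply pw_ge0]. }
  lra.
Qed.

Lemma abs_ray_le (psi r th : R) : Rabs (ray a eta y psi r th) <= exp (ray_re a eta y r th).
Proof.
  unfold ray. rewrite Rabs_mult, Rabs_pos_eq by (left; apply exp_pos).
  rewrite <- Rmult_1_r. apply Rmult_le_compat_l; [left; apply exp_pos |].
  apply Rabs_le. apply COS_bound.
Qed.

Lemma abs_ray_le_1 (psi r th : R) : 0 <= r -> - (PI / 2) <= th <= 0 ->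
  Rabs (ray a eta y psi r th) <= 1.
Proof.
  intros Hr Hth. eapply Rle_trans; [apply abs_ray_le |].
  rewrite <- exp_0. apply exp_le. now apply ray_re_le_0.
Qed.

(** The arc is split at th = -pi/4. Below it -sin th >= sin(pi/4); above it a(pi/2 - th) is at most
    (1/2)(3 pi/4) = 3 pi/8. The first term is written with [pw 1 M] so that one limit lemma serves
    both. *)
Definition arc_bound (M : R) : R :=
  M * exp (- (y * sin (PI / 4) * pw 1 M)) + M * exp (- (eta * cos (3 * (PI / 8)) * pw a M)).

Lemma arc_bound_lim : is_lim arc_bound p_infty 0.
Proof.
  assert (HP := PI_RGT_0).
  replace (Finite 0) with (Finite (0 + 0)) by (f_equal; ring).
  apply is_lim_plus'; apply is_lim_mul_exp_pw; try lra; apply Rmult_lt_0_compat; auto.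
  - apply sin_gt_0; lra.
  - apply cos_gt_0; lra.
Qed.

(* Near the real axis the factor exp(-eta (-i beta)^a) makes the arc contribution small,
   near the imaginary axis the factor exp(-i y beta) does. *)
Lemma exp_ray_re_le_arc_bound (M th : R) : 0 < M -> - (PI / 2) <= th <= 0 ->
  M * exp (ray_re a eta y M th) <= arc_bound M.
Proof.
  intros HM Hth. assert (HP := PI_RGT_0). unfold arc_bound.
  pose proof (ray_angle_bounds th Hth) as Hb.
  assert (Hs : 0 <= - sin th) by (rewrite <- sin_neg; apply sin_ge_0; lra).
  assert (Hc : 0 <= cos (a * (th - PI / 2))) by (apply cos_ge_0; lra).
  pose proof (pw_ge0 a M) as Hp.
  assert (HepM : 0 <= eta * pw a M) by (apply Rmult_le_pos; lra).
  assert (HyM : 0 <= y * M) by (apply Rmult_le_pos; lra).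
  pose proof (exp_pos (- (y * sin (PI / 4) * pw 1 M))).
  pose proof (exp_pos (- (eta * cos (3 * (PI / 8)) * pw a M))).
  rewrite <- Rmult_plus_distr_l. apply Rmult_le_compat_l; [lra |].
  unfold ray_re. destruct (Rle_dec th (- (PI / 4))) as [H1 | H1].
  - apply Rle_trans with (exp (- (y * sin (PI / 4) * pw 1 M))); [apply exp_le | lra].
    rewrite pw_1, Rabs_pos_eq by lra.
    assert (sin (PI / 4) <= - sin th).
    { rewrite <- sin_neg. apply sin_incr_1; lra. }
    assert (y * M * sin (PI / 4) <= y * M * - sin th) by (apply Rmult_le_compat_l; auto).
    assert (0 <= eta * pw a M * cos (a * (th - PI / 2))) by (apply Rmult_le_pos; auto).
    lra.
  - apply Rle_trans with (exp (- (eta * cos (3 * (PI / 8)) * pw a M))); [apply exp_le | lra].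
    assert (cos (3 * (PI / 8)) <= cos (a * (th - PI / 2))).
    { rewrite <- cos_neg with (x := a * (th - PI / 2)). apply cos_decr_1; try lra. nra. }
    assert (eta * pw a M * cos (3 * (PI / 8)) <= eta * pw a M * cos (a * (th - PI / 2)))
      by (apply Rmult_le_compat_l; auto).
    assert (0 <= y * M * - sin th) by (apply Rmult_le_pos; auto).
    lra.
Qed.

(** Mean value theorem in the angle for the integral over [e, M]: the derivative consists of the
    outer arc term, at most [arc_bound M], and an inner one, at most e. Near 0 the integrand is at
    most 1 in absolute value. *)
Lemma ray_integral_rotation_bound (psi M : R) : 0 < M ->
  Rabs (RInt (fun r => ray a eta y psi r 0) 0 M - RInt (fun r => ray a eta y psi r (- (PI / 2))) 0 M)
  <= PI / 2 * arc_bound M.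
Proof.
  intros HM. assert (HP := PI_RGT_0).
  assert (HC : forall th x, continuous (fun r => ray a eta y psi r th) x)
    by (intros; apply continuous_ray; lra).
  apply le_epsilon. intros eps Heps.
  (* The total error is 2 e from the integrals over [0, e] at the two angles, plus (pi/2) e from the
     inner arc. *)
  set (e := Rmin M (eps / (PI / 2 + 2))).
  assert (He : 0 < e <= M).
  { split; [apply Rmin_glb_lt; auto; apply Rdiv_lt_0_compat; lra | apply Rmin_l]. }
  assert (Hee : (PI / 2 + 2) * e <= eps).
  { apply Rle_trans with ((PI / 2 + 2) * (eps / (PI / 2 + 2))).
    - apply Rmult_le_compat_l; [lra | apply Rmin_r].
    - right. field. lra. }
  assert (Hsmall : forall th, - (PI / 2) <= th <= 0 ->
    Rabs (RInt (fun r => ray a eta y psi r th) 0 e) <= e).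
  { intros th Hth. replace e with ((e - 0) * 1) at 2 by ring.
    apply abs_RInt_le_const; [lra | now apply ex_RInt_cont |].
    intros r Hr. apply abs_ray_le_1; lra. }
  rewrite <- !(RInt_Chasles (V := R_CompleteNormedModule) _ 0 e M) by now apply ex_RInt_cont.
  unfold plus; simpl.
  destruct (MVT_gen (fun th => RInt (fun r => ray a eta y psi r th) e M) (- (PI / 2)) 0
    (fun th => M * ray a eta y (psi + PI / 2) M th - e * ray a eta y (psi + PI / 2) e th))
    as [c [Hc E]].
  - intros th _. apply is_derive_ray_integral; lra.
  - intros th _. apply ex_derive_continuity_pt. eexists. apply is_derive_ray_integral; lra.
  - rewrite Rmin_left, Rmax_right in Hc by lra.
    pose proof (Hsmall 0 ltac:(lra)) as S1. pose proof (Hsmall (- (PI / 2)) ltac:(lra)) as S2.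
    assert (B1 : Rabs (M * ray a eta y (psi + PI / 2) M c) <= arc_bound M).
    { rewrite Rabs_mult, Rabs_pos_eq by lra.
      eapply Rle_trans; [| apply (exp_ray_re_le_arc_bound M c); lra].
      apply Rmult_le_compat_l; [lra | apply abs_ray_le]. }
    assert (B2 : Rabs (e * ray a eta y (psi + PI / 2) e c) <= e).
    { rewrite Rabs_mult, Rabs_pos_eq by lra. rewrite <- Rmult_1_r.
      apply Rmult_le_compat_l; [lra | apply abs_ray_le_1; lra]. }
    apply Rabs_le_between in S1, S2, B1, B2. apply Rabs_le.
    nra.
Qed.

Lemma half_line_rotation (psi L : R) :
  half_line_integral (fun r => ray a eta y psi r (- (PI / 2))) L ->
  half_line_integral (fun r => ray a eta y psi r 0) L.
Proof.
  intros HL. assert (HP := PI_RGT_0).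
  set (D := fun M => RInt (fun r => ray a eta y psi r 0) 0 M
                     - RInt (fun r => ray a eta y psi r (- (PI / 2))) 0 M).
  assert (HK : is_lim (fun M => PI / 2 * arc_bound M) p_infty 0).
  { replace (Finite 0) with (Rbar_mult (PI / 2) 0) by (simpl; f_equal; ring).
    apply is_lim_scal_l, arc_bound_lim. }
  assert (HD : is_lim D p_infty 0).
  { apply is_lim_le_le_loc with (f := fun M => - (PI / 2 * arc_bound M))
                                (g := fun M => PI / 2 * arc_bound M); auto.
    - exists 0. intros M HM. apply Rabs_le_between. now apply ray_integral_rotation_bound.
    - replace (Finite 0) with (Rbar_opp 0) by (simpl; f_equal; ring). now apply is_lim_opp. }
  apply is_lim_ext with (f := fun M => D M + RInt (fun r => ray a eta y psi r (- (PI / 2))) 0 M).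
  - intros M. unfold D. ring.
  - replace (Finite L) with (Finite (0 + L)) by (f_equal; ring). now apply is_lim_plus'.
Qed.

End Rotation.

(** * Expansion of the rotated integral *)

(* The n-th derivative in rho of Im exp(-rho e^(-i w)). *)
Definition damped_sine (w : R) (n : nat) (rho : R) : R :=
  (-1) ^ n * (exp (- (rho * cos w)) * sin (rho * sin w - INR n * w)).

Lemma is_derive_damped_sine (w : R) (n : nat) (rho : R) :
  is_derive (damped_sine w n) rho (damped_sine w (S n) rho).
Proof.
  unfold damped_sine. auto_derive; [auto |]. rewrite S_INR. simpl pow.
  replace (rho * sin w - (INR n + 1) * w) with (rho * sin w - INR n * w - w) by ring.
  rewrite (sin_minus _ w). unfold Rminus. ring.
Qed.

Lemma Derive_n_damped_sine (w : R) (n : nat) (rho : R) :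
  Derive_n (damped_sine w 0) n rho = damped_sine w n rho.
Proof.
  revert rho. induction n as [|n IH]; intros rho; [reflexivity |]. simpl Derive_n.
  rewrite (Derive_ext _ (damped_sine w n)) by apply IH.
  apply is_derive_unique, is_derive_damped_sine.
Qed.

Lemma damped_sine_taylor (w rho : R) (n : nat) : 0 <= cos w -> 0 < rho ->
  Rabs (damped_sine w 0 rho
        - sum_f_R0 (fun m => rho ^ m / INR (fact m) * damped_sine w m 0) n)
  <= rho ^ S n / INR (fact (S n)).
Proof.
  intros Hw Hrho.
  destruct (Taylor_Lagrange (damped_sine w 0) n 0 rho Hrho) as [zeta [Hz E]].
  - intros t _ k _. destruct k as [|k]; [exact I |].
    apply ex_derive_ext with (f := damped_sine w k).
    + intros u. symmetry. apply Derive_n_damped_sine.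
    + eexists. apply is_derive_damped_sine.
  - rewrite !Rminus_0_r in E. rewrite E, Derive_n_damped_sine.
    rewrite (sum_eq _ (fun m => rho ^ m / INR (fact m) * damped_sine w m 0))
      by (intros i _; now rewrite Derive_n_damped_sine).
    match goal with |- Rabs ?v <= _ =>
      replace v with (rho ^ S n / INR (fact (S n)) * damped_sine w (S n) zeta) by ring end.
    assert (H0 : 0 <= rho ^ S n / INR (fact (S n))).
    { apply Rmult_le_pos; [apply pow_le; lra | left; apply Rinv_0_lt_compat, INR_fact_lt_0]. }
    rewrite Rabs_mult, Rabs_pos_eq by auto. rewrite <- Rmult_1_r.
    apply Rmult_le_compat_l; auto. unfold damped_sine. rewrite Rabs_mult, pow_1_abs, Rmult_1_l.
    rewrite Rabs_mult, Rabs_pos_eq by (left; apply exp_pos).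
    apply Rle_trans with (1 * 1); [| lra].
    apply Rmult_le_compat; try apply Rabs_pos; [left; apply exp_pos | |].
    + rewrite <- exp_0. apply exp_le. assert (0 <= zeta * cos w) by (apply Rmult_le_pos; lra). lra.
    + apply Rabs_le, SIN_bound.
Qed.

(** * Laplace transforms of powers *)

Definition laplace_integrand (y s r : R) : R := exp (- y * r) * pw s r.

Lemma continuous_laplace_integrand (y s r : R) : 0 < s -> continuous (laplace_integrand y s) r.
Proof.
  intros Hs. apply (continuous_mult (K := R_AbsRing)).
  - apply (ex_derive_continuous (V := R_NormedModule)). auto_derive. auto.
  - now apply continuous_pw.
Qed.

Lemma pw_mult (s x y : R) : 0 < x -> 0 < y -> pw s (x * y) = pw s x * pw s y.
Proof.
  intros Hx Hy. rewrite !pw_pos by (auto; now apply Rmult_lt_0_compat).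
  rewrite ln_mult, Rmult_plus_distr_l, exp_plus; auto.
Qed.

Lemma laplace_transform_pw (y s : R) : 0 < s -> 0 < y ->
  half_line_integral (laplace_integrand y s) (gamma_plus s / pw (s + 1) y).
Proof.
  intros Hs Hy.
  assert (Hp : pw (s + 1) y <> 0)
    by (rewrite pw_pos by auto; pose proof (exp_pos ((s + 1) * ln y)); lra).
  apply is_lim_ext_loc
    with (f := fun M => / pw (s + 1) y * RInt (gamma_integrand s) 0 (y * M)).
  - exists 0. intros M HM.
    replace (RInt (gamma_integrand s) 0 (y * M))
      with (RInt (gamma_integrand s) (y * 0 + 0) (y * M + 0)) by (f_equal; ring).
    rewrite <- (RInt_comp_lin (V := R_CompleteNormedModule))
      by (apply ex_RInt_cont; intros; now apply continuous_gamma_integrand).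
    rewrite (RInt_ext _ (fun r => scal (pw (s + 1) y) (laplace_integrand y s r))).
    + rewrite (RInt_scal (V := R_CompleteNormedModule))
        by (apply ex_RInt_cont; intros; now apply continuous_laplace_integrand).
      unfold scal; simpl; unfold mult; simpl. field. auto.
    + intros r Hr. rewrite Rmin_left in Hr by lra.
      unfold gamma_integrand, laplace_integrand, scal; simpl; unfold mult; simpl.
      rewrite Rplus_0_r, pw_mult, pw_succ, Rabs_pos_eq by lra.
      replace (- (y * r)) with (- y * r) by ring.
      apply Rminus_diag_uniq. ring.
  - replace (Finite (gamma_plus s / pw (s + 1) y))
      with (Rbar_mult (/ pw (s + 1) y) (gamma_plus s)) by (simpl; f_equal; field; auto).
    apply is_lim_scal_l.
    apply (is_lim_comp (fun M => RInt (gamma_integrand s) 0 M) (fun M => y * M)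
             p_infty (gamma_plus s) p_infty).
    + now apply gamma_plus_correct.
    + apply is_lim_scal_l_p_infty; [auto | apply is_lim_id].
    + exists 0. intros; discriminate.
Qed.

(** Continuity is carried along because [half_line_lin] asks for it at each step of the
    induction. *)
Lemma half_line_sum (h : nat -> R -> R) (c m : nat -> R) (N : nat) :
  (forall k x, continuous (h k) x) -> (forall k, half_line_integral (h k) (m k)) ->
  (forall x, continuous (fun r => sum_f_R0 (fun k => c k * h k r) N) x) /\
  half_line_integral (fun r => sum_f_R0 (fun k => c k * h k r) N)
                     (sum_f_R0 (fun k => c k * m k) N).
Proof.
  intros Hc Hm. induction N as [|N [IH1 IH2]].
  - simpl. split.
    + intros x. now apply (continuous_scal_r (V := R_NormedModule)).
    + replace (c 0%nat * m 0%nat) with (c 0%nat * m 0%nat + 0 * m 0%nat) by ring.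
      apply half_line_ext with (f := fun r => c 0%nat * h 0%nat r + 0 * h 0%nat r).
      * intros; ring.
      * now apply half_line_lin.
  - simpl. split.
    + intros x. apply (continuous_plus (V := R_NormedModule)); auto.
      now apply (continuous_scal_r (V := R_NormedModule)).
    + replace (sum_f_R0 (fun k => c k * m k) N + c (S N) * m (S N))
        with (1 * sum_f_R0 (fun k => c k * m k) N + c (S N) * m (S N)) by ring.
      eapply half_line_ext; [| apply (half_line_lin _ (h (S N)) 1 (c (S N)) _ (m (S N)) IH1);
                               [apply Hc | exact IH2 | apply Hm]].
      intros r _. simpl. ring.
Qed.

Lemma half_line_exp (K d : R) : 0 < d ->
  half_line_integral (fun r => K * exp (- d * r)) (K / d).
Proof.
  intros Hd. apply is_lim_ext with (f := fun M => K / d * (1 - exp (- (d * M)))).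
  - intros M. rewrite (RInt_scal (V := R_CompleteNormedModule) (fun r => exp (- d * r))).
    + rewrite RInt_exp_neg by auto. unfold scal; simpl; unfold mult; simpl.
      replace (- (d * M)) with (- d * M) by ring. field. lra.
    + apply ex_RInt_cont. intros x. apply (ex_derive_continuous (V := R_NormedModule)).
      auto_derive. auto.
  - replace (Finite (K / d)) with (Rbar_mult (K / d) (1 - 0)) by (simpl; f_equal; ring).
    apply is_lim_scal_l, is_lim_minus'; [apply is_lim_const |].
    apply is_lim_exp_neg, is_lim_scal_l_p_infty; [auto | apply is_lim_id].
Qed.

Lemma exp_partial_sum_le (x : R) (n : nat) : 0 <= x ->
  sum_f_R0 (fun k => x ^ S k / INR (fact (S k))) n <= exp x.
Proof.
  intros Hx.
  assert (Hpos : forall k, 0 <= x ^ k / INR (fact k)).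
  { intros k. apply Rmult_le_pos; [now apply pow_le | left; apply Rinv_0_lt_compat, INR_fact_lt_0]. }
  apply Rle_trans with (sum_f_R0 (fun k => x ^ k / INR (fact k)) (S n)).
  - rewrite (decomp_sum _ (S n)) by lia. change (Init.Nat.pred (S n)) with n.
    pose proof (Hpos 0%nat). lra.
  - pose proof (is_exp_Reals x) as HE.
    rewrite <- (is_pseries_unique _ _ _ HE). unfold PSeries.
    assert (HS : ex_series (fun k => / INR (fact k) * x ^ k)).
    { exists (exp x). apply is_series_ext with (2 := HE). intros k.
      rewrite pow_n_pow. unfold scal; simpl; unfold mult; simpl. apply Rmult_comm. }
    rewrite (sum_eq _ (fun k => / INR (fact k) * x ^ k)) by (intros; unfold Rdiv; ring).
    rewrite <- sum_n_Reals.
    apply (is_lim_seq_incr_compare (sum_n (fun k => / INR (fact k) * x ^ k))).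
    + apply Series_correct in HS. exact HS.
    + intros k. rewrite sum_Sn. unfold plus; simpl. pose proof (Hpos (S k)) as H.
      unfold Rdiv in H. rewrite Rmult_comm in H. simpl in *. lra.
Qed.

Section Expansion.

Variables (a eta y : R).
Hypotheses (Ha : 0 < a <= 1 / 2) (Heta : 0 < eta) (Hy : 0 < y).

(** Index k stands for the term n = k + 1 of the expansion, the term n = 0 being zero. With a =
    nu/2, the argument of [rgamma] in u is 1 - [exponent k]. *)
Definition exponent (k : nat) : R := a * INR (S k).

Lemma exponent_pos (k : nat) : 0 < exponent k.
Proof. apply Rmult_lt_0_compat; [lra | apply lt_0_INR; lia]. Qed.

Definition moment (k : nat) : R := gamma_plus (exponent k) / pw (exponent k + 1) y.

Definition coef (k : nat) : R := eta ^ S k / INR (fact (S k)).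

Lemma coef_pos (k : nat) : 0 < coef k.
Proof.
  apply Rmult_lt_0_compat; [now apply pow_lt | apply Rinv_0_lt_compat, INR_fact_lt_0].
Qed.

Lemma moment_correct (k : nat) : half_line_integral (laplace_integrand y (exponent k)) (moment k).
Proof. apply laplace_transform_pw; auto. apply exponent_pos. Qed.

Lemma moment_ge0 (k : nat) : 0 <= moment k.
Proof.
  apply half_line_le with (f := fun _ => 0) (g := laplace_integrand y (exponent k)).
  - intros; apply continuous_const.
  - intros; apply continuous_laplace_integrand, exponent_pos.
  - intros r _. apply Rmult_le_pos; [left; apply exp_pos | apply pw_ge0].
  - apply is_lim_ext with (f := fun _ => 0); [| apply is_lim_const].
    intros M. rewrite RInt_const. unfold scal; simpl; unfold mult; simpl. ring.
  - apply moment_correct.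
Qed.

(** For r <= 1 the power is at most 1; for r > 1 it is at most the square root of r, since a <= 1/2.
    The constant adds the bounds of the two cases. *)
Lemma pw_le_linear (r : R) : 0 < r -> eta * pw a r <= y / 2 * r + (eta + eta ^ 2 / (2 * y)).
Proof.
  intros Hr. rewrite pw_pos by auto.
  assert (H0 : 0 <= eta ^ 2 / (2 * y))
    by (apply Rmult_le_pos; [apply pow2_ge_0 | left; apply Rinv_0_lt_compat; lra]).
  destruct (Rle_dec r 1) as [H | H].
  - assert (ln r <= 0) by (rewrite <- ln_1; destruct H as [H | ->]; [left; now apply ln_increasing | lra]).
    assert (exp (a * ln r) <= 1) by (rewrite <- exp_0; apply exp_le; nra).
    assert (0 <= y / 2 * r) by (apply Rmult_le_pos; lra).
    assert (eta * exp (a * ln r) <= eta * 1) by (apply Rmult_le_compat_l; lra). lra.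
  - assert (0 < ln r) by (rewrite <- ln_1; apply ln_increasing; lra).
    set (X := exp (1 / 2 * ln r)).
    assert (HX : X * X = r) by (unfold X; rewrite <- exp_plus; replace (1 / 2 * ln r + 1 / 2 * ln r) with (ln r) by field; now apply exp_ln).
    assert (exp (a * ln r) <= X) by (apply exp_le; nra).
    assert (eta * exp (a * ln r) <= eta * X) by (apply Rmult_le_compat_l; lra).
    assert (eta * X <= y / 2 * r + eta ^ 2 / (2 * y)); [| lra].
    rewrite <- HX.
    (* Completing the square in X, the square root of r. *)
    assert (0 <= (y * X - eta) ^ 2 / (2 * y))
      by (apply Rmult_le_pos; [apply pow2_ge_0 | left; apply Rinv_0_lt_compat; lra]).
    assert ((y * X - eta) ^ 2 / (2 * y) = y / 2 * (X * X) + eta ^ 2 / (2 * y) - eta * X)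
      by (field; lra). lra.
Qed.

(* sum_k eta^k r^(ak) / k! = exp(eta r^a) grows slower than exp(y r / 2). *)
Lemma coef_moment_vanish : is_lim_seq (fun k => coef k * moment k) 0.
Proof.
  apply ex_series_lim_0.
  set (K := exp (eta + eta ^ 2 / (2 * y))).
  (* Each partial sum integrates a partial sum of exp(eta r^a) against exp(-y r), a product bounded
     by K exp(-y r/2). As the terms are nonnegative, the series converges and its terms tend to
     0. *)
  assert (HB : forall N, sum_f_R0 (fun k => coef k * moment k) N <= K / (y / 2)).
  { intros N.
    destruct (half_line_sum (fun k => laplace_integrand y (exponent k)) coef moment N) as [H1 H2].
    - intros; apply continuous_laplace_integrand, exponent_pos.
    - apply moment_correct.
    - eapply half_line_le; [exact H1 | | | exact H2 | apply (half_line_exp K (y / 2)); lra].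
      + intros x. apply (ex_derive_continuous (V := R_NormedModule)). auto_derive. auto.
      + intros r Hr. cbv beta.
        rewrite (sum_eq _ (fun k => (eta * pw a r) ^ S k / INR (fact (S k)) * exp (- y * r))).
        * rewrite <- scal_sum.
          assert (Hp : 0 <= eta * pw a r) by (apply Rmult_le_pos; [lra | apply pw_ge0]).
          apply Rle_trans with (exp (- y * r) * exp (eta * pw a r)).
          -- apply Rmult_le_compat_l; [left; apply exp_pos | now apply exp_partial_sum_le].
          -- unfold K. rewrite <- !exp_plus. apply exp_le. pose proof (pw_le_linear r Hr). lra.
        * intros k _. unfold coef, laplace_integrand, exponent.
          rewrite pw_pow, Rpow_mult_distr. field. apply INR_fact_neq_0. }
  destruct (ex_finite_lim_seq_incr (sum_n (fun k => coef k * moment k)) (K / (y / 2))) as [l Hl].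
  - intros N. rewrite sum_Sn. unfold plus; simpl.
    pose proof (Rmult_le_pos _ _ (Rlt_le _ _ (coef_pos (S N))) (moment_ge0 (S N))). lra.
  - intros N. rewrite sum_n_Reals. apply HB.
  - exists l. exact Hl.
Qed.

Definition sine_term (k : nat) : R := (-1) ^ k * sin (PI * exponent k) * coef k * moment k.

(** The term m = 0 is sin 0; in the others the sign from sin(-m pi a) turns (-1)^(k+1) into
    (-1)^k. *)
Lemma damped_sine_partial_sum (rho : R) (N : nat) :
  sum_f_R0 (fun m => rho ^ m / INR (fact m) * damped_sine (PI * a) m 0) (S N)
  = sum_f_R0 (fun k => (-1) ^ k * sin (PI * exponent k) * (rho ^ S k / INR (fact (S k)))) N.
Proof.
  rewrite (decomp_sum _ (S N)) by lia. change (Init.Nat.pred (S N)) with N.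
  unfold damped_sine at 1. rewrite !Rmult_0_l, Rminus_0_r, sin_0, !Rmult_0_r, Rplus_0_l.
  apply sum_eq. intros k _. unfold damped_sine, exponent.
  rewrite !Rmult_0_l, Ropp_0, exp_0.
  replace (0 - INR (S k) * (PI * a)) with (- (PI * (a * INR (S k)))) by ring.
  rewrite sin_neg. simpl pow. ring.
Qed.

Definition cut_integrand (r : R) : R := exp (- y * r) * damped_sine (PI * a) 0 (eta * pw a r).

Lemma continuous_cut_integrand (r : R) : continuous cut_integrand r.
Proof.
  apply (continuous_mult (K := R_AbsRing)).
  - apply (ex_derive_continuous (V := R_NormedModule)). auto_derive. auto.
  - apply (continuous_comp_R (fun r => eta * pw a r) (damped_sine (PI * a) 0)).
    + apply (continuous_scal_r (V := R_NormedModule)), continuous_pw. lra.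
    + eexists. apply is_derive_damped_sine.
Qed.

Lemma cos_PI_mul_ge0 : 0 <= cos (PI * a).
Proof. assert (HP := PI_RGT_0). apply cos_ge_0; nra. Qed.

(* Since cos(pi a) >= 0 for a <= 1/2, the Taylor remainder is bounded by the first omitted term. *)
Lemma cut_integral_partial_sum (L : R) (N : nat) : half_line_integral cut_integrand L ->
  Rabs (L - sum_f_R0 sine_term N) <= coef (S N) * moment (S N).
Proof.
  intros HL.
  set (h := fun k => laplace_integrand y (exponent k)).
  assert (Hh : forall k x, continuous (h k) x)
    by (intros; apply continuous_laplace_integrand, exponent_pos).
  destruct (half_line_sum h (fun k => (-1) ^ k * sin (PI * exponent k) * coef k) moment N Hh
              moment_correct) as [HS1 HS2].
  change (sum_f_R0 (fun k => (-1) ^ k * sin (PI * exponent k) * coef k * moment k) N)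
    with (sum_f_R0 sine_term N) in HS2.
  set (P := fun r => sum_f_R0 (fun k => (-1) ^ k * sin (PI * exponent k) * coef k * h k r) N) in *.
  assert (Hb : forall r, 0 < r -> Rabs (cut_integrand r - P r) <= coef (S N) * h (S N) r).
  { intros r Hr.
    assert (Hp : 0 < eta * pw a r)
      by (apply Rmult_lt_0_compat; [lra | rewrite pw_pos by auto; apply exp_pos]).
    (* Order N + 1, because index k of the series is the Taylor term k + 1; the remainder then
       matches [coef (S N)]. *)
    pose proof (damped_sine_taylor (PI * a) (eta * pw a r) (S N) cos_PI_mul_ge0 Hp) as HT.
    rewrite damped_sine_partial_sum in HT.
    replace (cut_integrand r - P r) with (exp (- y * r) *
      (damped_sine (PI * a) 0 (eta * pw a r) - sum_f_R0 (fun k => (-1) ^ k * sin (PI * exponent k)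
         * ((eta * pw a r) ^ S k / INR (fact (S k)))) N)).
    - rewrite Rabs_mult, Rabs_pos_eq by (left; apply exp_pos).
      eapply Rle_trans; [apply Rmult_le_compat_l; [left; apply exp_pos | exact HT] |].
      right. unfold coef, h, laplace_integrand, exponent. rewrite pw_pow, Rpow_mult_distr.
      field. apply INR_fact_neq_0.
    - unfold P, cut_integrand. rewrite Rmult_minus_distr_l, scal_sum. f_equal.
      apply sum_eq. intros k _. unfold coef, h, laplace_integrand, exponent.
      rewrite pw_pow, Rpow_mult_distr. field. apply INR_fact_neq_0. }
  assert (HD : half_line_integral (fun r => 1 * cut_integrand r + -1 * P r)
                 (1 * L + -1 * sum_f_R0 sine_term N)).
  { apply half_line_lin; auto. apply continuous_cut_integrand. }
  assert (HDc : forall x, continuous (fun r => 1 * cut_integrand r + -1 * P r) x).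
  { intros x. apply (continuous_plus (V := R_NormedModule));
      apply (continuous_scal_r (V := R_NormedModule)); auto. apply continuous_cut_integrand. }
  (* The zero summand brings a scalar multiple into the shape of [half_line_lin]. *)
  assert (HR : forall c, half_line_integral (fun r => c * h (S N) r + 0 * h (S N) r)
                 (c * moment (S N) + 0 * moment (S N))).
  { intros c. apply half_line_lin; auto; apply moment_correct. }
  assert (HRc : forall c x, continuous (fun r => c * h (S N) r + 0 * h (S N) r) x).
  { intros c x. apply (continuous_plus (V := R_NormedModule));
      apply (continuous_scal_r (V := R_NormedModule)); auto. }
  apply Rabs_le. split.
  - assert (- coef (S N) * moment (S N) + 0 * moment (S N)
            <= 1 * L + -1 * sum_f_R0 sine_term N); [| lra].
    eapply half_line_le; [apply HRc | exact HDc | | apply HR | exact HD].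
    intros r Hr. specialize (Hb r Hr). apply Rabs_le_between in Hb. cbv beta. lra.
  - assert (1 * L + -1 * sum_f_R0 sine_term N
            <= coef (S N) * moment (S N) + 0 * moment (S N)); [| lra].
    eapply half_line_le; [exact HDc | apply HRc | | exact HD | apply HR].
    intros r Hr. specialize (Hb r Hr). apply Rabs_le_between in Hb. cbv beta. lra.
Qed.

Lemma cut_integral_series (L : R) : half_line_integral cut_integrand L -> is_series sine_term L.
Proof.
  intros HL. change (is_lim_seq (sum_n sine_term) L).
  assert (H0 : is_lim_seq (fun N => coef (S N) * moment (S N)) 0)
    by (apply (is_lim_seq_incr_1 (fun k => coef k * moment k)), coef_moment_vanish).
  apply is_lim_seq_le_le with (u := fun N => L - coef (S N) * moment (S N))
                              (w := fun N => L + coef (S N) * moment (S N)).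
  - intros N. rewrite sum_n_Reals. pose proof (cut_integral_partial_sum L N HL) as H.
    apply Rabs_le_between in H. lra.
  - replace (Finite L) with (Finite (L - 0)) by (f_equal; ring).
    apply is_lim_seq_minus'; [apply is_lim_seq_const | exact H0].
  - replace (Finite L) with (Finite (L + 0)) by (f_equal; ring).
    apply is_lim_seq_plus'; [apply is_lim_seq_const | exact H0].
Qed.

Lemma abs_ray_cut_le (psi r : R) : 0 <= r ->
  Rabs (ray a eta y psi r (- (PI / 2))) <= 1 * exp (- y * r).
Proof.
  intros Hr. eapply Rle_trans; [apply abs_ray_le |]. rewrite Rmult_1_l. apply exp_le.
  unfold ray_re. rewrite sin_neg, sin_PI2.
  replace (a * (- (PI / 2) - PI / 2)) with (- (PI * a)) by field. rewrite cos_neg.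
  assert (0 <= eta * pw a r * cos (PI * a)); [| lra].
  apply Rmult_le_pos; [apply Rmult_le_pos; [lra | apply pw_ge0] | apply cos_PI_mul_ge0].
Qed.

(** The Jacobian exp(-i pi/2) = -i turns the real part into the imaginary part, so the cosine
    becomes the sine of [damped_sine]. *)
Lemma ray_cut (r : R) : ray a eta y 0 r (- (PI / 2)) = cut_integrand r.
Proof.
  unfold ray, ray_re, ray_im, cut_integrand, damped_sine.
  rewrite sin_neg, sin_PI2, cos_neg, cos_PI2.
  replace (a * (- (PI / 2) - PI / 2)) with (- (PI * a)) by field. rewrite cos_neg, sin_neg.
  replace (- (PI / 2) - y * r * 0 - eta * pw a r * - sin (PI * a) + 0)
    with (- (PI / 2 - eta * pw a r * sin (PI * a))) by ring.
  rewrite cos_neg, cos_shift. simpl (INR 0). rewrite Rmult_0_l, Rminus_0_r, Rmult_1_l.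
  rewrite <- Rmult_assoc, <- exp_plus. f_equal. f_equal. ring.
Qed.

(** Convergence is inherited from the rotated ray, dominated by exp(-y r). A free phase is needed
    since the imaginary part of the density must converge before it can cancel. *)
Lemma half_line_real_axis (psi : R) : exists L, half_line_integral (fun r => ray a eta y psi r 0) L.
Proof.
  destruct (half_line_ex_dominated (fun r => ray a eta y psi r (- (PI / 2))) 1 y) as [L HL]; auto.
  - intros; apply continuous_ray; lra.
  - intros; now apply abs_ray_cut_le.
  - exists L. now apply half_line_rotation.
Qed.

Lemma half_line_real_axis_series : exists L,
  half_line_integral (fun r => ray a eta y 0 r 0) L /\ is_series sine_term L.
Proof.
  destruct (half_line_ex_dominated (fun r => ray a eta y 0 r (- (PI / 2))) 1 y) as [L HL]; auto.
  - intros; apply continuous_ray; lra.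
  - intros; now apply abs_ray_cut_le.
  - exists L. split; [now apply half_line_rotation |]. apply cut_integral_series.
    eapply half_line_ext; [| exact HL]. intros r _. apply ray_cut.
Qed.

End Expansion.

(** * The stable density *)

(** The two ends of the line tend to infinity independently, so even an odd integrand requires a
    convergent half-line integral. The sign [sg] is 1 for the real part and -1 for the imaginary
    part. *)
Lemma is_RInt_gen_parity (f g : R -> R) (sg L : R) :
  (forall x, continuous g x) -> half_line_integral g L ->
  (forall b, 0 < b -> f b = g b) -> (forall b, 0 < b -> f (- b) = sg * g b) ->
  is_RInt_gen f (Rbar_locally m_infty) (Rbar_locally p_infty) (sg * L + L).
Proof.
  intros Hg HL Hpos Hneg.
  assert (HI : forall M N, 0 < M -> 0 < N ->
    is_RInt f (- M) N (sg * RInt g 0 M + RInt g 0 N)).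
  { intros M N HM HN.
    apply (is_RInt_Chasles (V := R_NormedModule) f (- M) 0 N).
    - apply is_RInt_ext with (f := fun b => opp (scal (- sg) (g (- b)))).
      + rewrite Rmin_left, Rmax_right by lra. intros b Hb.
        unfold opp, scal; simpl; unfold mult; simpl.
        replace (f b) with (f (- - b)) by (f_equal; ring).
        rewrite Hneg by lra. apply Rminus_diag_uniq. ring.
      + apply (is_RInt_comp_opp (V := R_NormedModule) (fun b => scal (- sg) (g b))).
        rewrite Ropp_involutive, Ropp_0.
        replace (sg * RInt g 0 M) with (opp (scal (- sg) (RInt g 0 M)))
          by (unfold opp, scal; simpl; unfold mult; simpl; ring).
        apply (is_RInt_swap (V := R_NormedModule)), (is_RInt_scal (V := R_NormedModule)).
        apply (RInt_correct (V := R_CompleteNormedModule)). now apply ex_RInt_cont.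
    - apply is_RInt_ext with (f := g).
      + rewrite Rmin_left by lra. intros b Hb. symmetry. apply Hpos. lra.
      + apply (RInt_correct (V := R_CompleteNormedModule)). now apply ex_RInt_cont. }
  intros P [eps HP].
  (* The left half contributes |sg| times this tolerance, the right half one time. *)
  assert (Hd : 0 < eps / (Rabs sg + 1))
    by (apply Rdiv_lt_0_compat; [apply eps | pose proof (Rabs_pos sg); lra]).
  apply is_lim_spec in HL. destruct (HL (mkposreal _ Hd)) as [M0 HM0]. simpl in HM0.
  apply Filter_prod with (Q := fun a => a < - Rmax 0 M0) (R := fun b => Rmax 0 M0 < b).
  - now exists (- Rmax 0 M0).
  - now exists (Rmax 0 M0).
  - intros a b Ha Hb. pose proof (Rmax_l 0 M0). pose proof (Rmax_r 0 M0).
    exists (sg * RInt g 0 (- a) + RInt g 0 b). split.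
    + simpl. replace a with (- - a) at 1 by ring. apply HI; lra.
    + apply HP. unfold ball; simpl; unfold AbsRing_ball, abs, minus, plus, opp; simpl.
      replace (sg * RInt g 0 (- a) + RInt g 0 b + - (sg * L + L))
        with (sg * (RInt g 0 (- a) - L) + (RInt g 0 b - L)) by ring.
      eapply Rle_lt_trans; [apply Rabs_triang |]. rewrite Rabs_mult.
      pose proof (HM0 (- a) ltac:(lra)) as B1. pose proof (HM0 b ltac:(lra)) as B2.
      assert (Rabs sg * Rabs (RInt g 0 (- a) - L) <= Rabs sg * (eps / (Rabs sg + 1)))
        by (apply Rmult_le_compat_l; [apply Rabs_pos | lra]).
      replace (pos eps) with (Rabs sg * (eps / (Rabs sg + 1)) + eps / (Rabs sg + 1))
        by (field; pose proof (Rabs_pos sg); lra).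
      lra.
Qed.

Lemma stable_integrand_eq (a eta y b : R) :
  stable_integrand a a eta y b =
  (exp (- (eta * pw a b * cos (PI * a / 2)))
     * cos (- b * y + eta * pw a b * sin (PI * a / 2 * sgn b)),
   exp (- (eta * pw a b * cos (PI * a / 2)))
     * sin (- b * y + eta * pw a b * sin (PI * a / 2 * sgn b))).
Proof.
  assert (Hc : cos (- (PI * a / 2) * sgn b) = cos (PI * a / 2)).
  { unfold sgn. destruct (Rlt_dec b 0).
    - f_equal. ring.
    - rewrite Rmult_1_r. apply cos_neg. }
  unfold stable_integrand, cexp, Cmult, RtoC. simpl fst. simpl snd.
  rewrite Hc, exp_0. replace (- (PI * a / 2) * sgn b) with (- (PI * a / 2 * sgn b)) by ring.
  rewrite sin_neg. fold (pw a b).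
  set (v := - eta * pw a b * (1 * - sin (PI * a / 2 * sgn b)) + 0 * (1 * cos (PI * a / 2))).
  replace (eta * pw a b * sin (PI * a / 2 * sgn b)) with v by (unfold v; ring).
  replace (- eta * pw a b * (1 * cos (PI * a / 2)) - 0 * (1 * - sin (PI * a / 2 * sgn b)))
    with (- (eta * pw a b * cos (PI * a / 2))) by ring.
  rewrite cos_plus, sin_plus. f_equal; ring.
Qed.

Lemma ray_0_eq (a eta y psi b : R) :
  ray a eta y psi b 0 = exp (- (eta * pw a b * cos (PI * a / 2)))
     * cos (- b * y + eta * pw a b * sin (PI * a / 2) + psi).
Proof.
  unfold ray, ray_re, ray_im. rewrite sin_0, cos_0.
  replace (a * (0 - PI / 2)) with (- (PI * a / 2)) by field. rewrite cos_neg, sin_neg.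
  f_equal; f_equal; ring.
Qed.

(** The even real part gives 2 L, hence L/pi after the factor 1/(2 pi); the odd imaginary part gives
    0. *)
Lemma stable_density_eq (a eta y L : R) : 0 < a <= 1 / 2 -> 0 < eta -> 0 < y ->
  half_line_integral (fun b => ray a eta y 0 b 0) L ->
  stable_density a a eta y = RtoC (L / PI).
Proof.
  intros Ha Heta Hy HL. assert (HP := PI_RGT_0).
  destruct (half_line_real_axis a eta y Ha Heta Hy (- (PI / 2))) as [L' HL'].
  assert (Hs1 : forall b, 0 < b -> sgn b = 1)
    by (intros b Hb; unfold sgn; destruct (Rlt_dec b 0); lra).
  assert (Hs2 : forall b, 0 < b -> sgn (- b) = -1)
    by (intros b Hb; unfold sgn; destruct (Rlt_dec (- b) 0); lra).
  assert (Hc : forall psi x, continuous (fun b => ray a eta y psi b 0) x)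
    by (intros; apply continuous_ray; lra).
  assert (Hshift : forall v, cos (v + - (PI / 2)) = sin v)
    by (intros v; rewrite cos_plus, cos_neg, sin_neg, cos_PI2, sin_PI2; ring).
  assert (H1 : is_RInt_gen (fun b => fst (stable_integrand a a eta y b))
                 (Rbar_locally m_infty) (Rbar_locally p_infty) (1 * L + L)).
  { apply is_RInt_gen_parity with (g := fun b => ray a eta y 0 b 0); auto.
    - intros b Hb. rewrite stable_integrand_eq, ray_0_eq, Hs1, Rmult_1_r, Rplus_0_r by auto. auto.
    - intros b Hb. rewrite stable_integrand_eq, ray_0_eq, Hs2, Rplus_0_r, pw_opp, Rmult_1_l by auto.
      simpl fst. f_equal. rewrite <- cos_neg. f_equal.
      replace (PI * a / 2 * -1) with (- (PI * a / 2)) by ring. rewrite sin_neg. ring. }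
  assert (H2 : is_RInt_gen (fun b => snd (stable_integrand a a eta y b))
                 (Rbar_locally m_infty) (Rbar_locally p_infty) (-1 * L' + L')).
  { apply is_RInt_gen_parity with (g := fun b => ray a eta y (- (PI / 2)) b 0); auto.
    - intros b Hb. rewrite stable_integrand_eq, ray_0_eq, Hs1, Rmult_1_r, Hshift by auto. auto.
    - intros b Hb. rewrite stable_integrand_eq, ray_0_eq, Hs2, Hshift, pw_opp by auto.
      simpl snd. replace (PI * a / 2 * -1) with (- (PI * a / 2)) by ring. rewrite sin_neg.
      replace (- - b * y + eta * pw a b * - sin (PI * a / 2))
        with (- (- b * y + eta * pw a b * sin (PI * a / 2))) by ring.
      rewrite sin_neg. ring. }
  apply (is_RInt_gen_unique (V := R_CompleteNormedModule)) in H1.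
  apply (is_RInt_gen_unique (V := R_CompleteNormedModule)) in H2.
  unfold stable_density.
  change (Cmult (RtoC (/ (2 * PI)))
     (@RInt_gen R_CompleteNormedModule (fun b => fst (stable_integrand a a eta y b))
             (Rbar_locally m_infty) (Rbar_locally p_infty),
      @RInt_gen R_CompleteNormedModule (fun b => snd (stable_integrand a a eta y b))
             (Rbar_locally m_infty) (Rbar_locally p_infty)) = RtoC (L / PI)).
  rewrite H1, H2. unfold Cmult, RtoC. simpl. f_equal; field; lra.
Qed.

(** * Matching with the series of u *)

(** Common source of both identities: any pair eta, y with eta / y^(nu/2) equal to the similarity
    variable z of u is admissible. *)
Lemma u_sol_stable_density (lam nu x t eta y : R) :
  0 < lam -> 0 < nu <= 1 -> x <> 0 -> 0 < t -> 0 < eta -> 0 < y ->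
  eta / pw (nu / 2) y = Rabs x / (lam * rpow t (nu / 2)) ->
  RtoC (u_sol lam nu x t) =
  Cmult (RtoC (y / (nu * Rabs x))) (stable_density (nu / 2) (nu / 2) eta y).
Proof.
  intros Hlam Hnu Hx Ht Heta Hy Hz. assert (HP := PI_RGT_0).
  assert (Ha : 0 < nu / 2 <= 1 / 2) by lra.
  destruct (half_line_real_axis_series (nu / 2) eta y Ha Heta Hy) as [L [HL HS]].
  rewrite (stable_density_eq _ _ _ L) by auto.
  assert (HX : 0 < Rabs x) by now apply Rabs_pos_lt.
  assert (HT : 0 < rpow t (nu / 2)) by (rewrite rpow_pos by auto; apply exp_pos).
  assert (Hpy : 0 < pw (nu / 2) y) by (rewrite pw_pos by auto; apply exp_pos).
  set (z := Rabs x / (lam * rpow t (nu / 2))) in *.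
  assert (Hz0 : z <> 0).
  { unfold z. apply Rgt_not_eq, Rdiv_lt_0_compat; auto. now apply Rmult_lt_0_compat. }
  assert (E : u_sol lam nu x t = y / (nu * Rabs x) * (L / PI)).
  - unfold u_sol.
    (* The factor y comes from y^(s+1) in the moment with s = a(k+1), the factor 1/z from z^(k+1)
       against z^k, and 1/(a pi) from 1/(pi s) in the reflection formula, whose k + 1 cancels
       against (k+1)!. *)
    rewrite (Series_ext _ (fun k => y / (z * (nu / 2) * PI) * sine_term (nu / 2) eta y k)).
    + rewrite Series_scal_l, (is_series_unique _ _ HS). unfold z. field. repeat split; lra.
    + intros k.
      assert (Hk : 0 < INR (S k)) by (apply lt_0_INR; lia).
      replace (- nu * INR k / 2 + 1 - nu / 2) with (1 - exponent (nu / 2) k)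
        by (unfold exponent; rewrite S_INR; field).
      pose proof (exponent_pos (nu / 2) Ha k) as He.
      rewrite rgamma_one_minus by auto.
      unfold sine_term, coef, moment.
      replace (- Rabs x / (lam * rpow t (nu / 2))) with (-1 * z) by (unfold z; field; lra).
      rewrite pw_succ, (Rabs_pos_eq y) by lra.
      (* This is eta = z y^a raised to the power k + 1. *)
      assert (Ep : eta ^ S k = z ^ S k * pw (exponent (nu / 2) k) y).
      { unfold exponent. rewrite pw_pow, <- Rpow_mult_distr. f_equal. rewrite <- Hz. field. lra. }
      rewrite Ep, Rpow_mult_distr, fact_simpl, mult_INR. simpl (z ^ S k).
      assert (Hpe : pw (exponent (nu / 2) k) y <> 0)
        by (rewrite pw_pos by auto; apply Rgt_not_eq, exp_pos).
      pose proof (INR_fact_neq_0 k).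
      generalize dependent (pw (exponent (nu / 2) k) y). intros p _ Hp.
      generalize (sin (PI * exponent (nu / 2) k)) (gamma_plus (exponent (nu / 2) k)). intros sn g.
      unfold exponent. field. repeat split; auto; lra.
  - rewrite E, RtoC_mult. reflexivity.
Qed.

Theorem theorem5p4 (lam nu : R) (Hlam : 0 < lam) (Hnu0 : 0 < nu) (Hnu1 : nu <= 1)
  (x t : R) (Hx : x <> 0) (Ht : 0 < t) :
  RtoC (u_sol lam nu x t) =
    Cmult (RtoC (/ nu * rpow lam (2 / nu) * t / rpow (Rabs x) (2 / nu + 1)))
          (stable_density (nu / 2) (nu / 2) 1
             (rpow lam (2 / nu) * t / rpow (Rabs x) (2 / nu)))
  /\
  RtoC (u_sol lam nu x t) =
    Cmult (RtoC (/ (nu * rpow (Rabs x) (2 / nu + 1))))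
          (stable_density (nu / 2) (nu / 2) (/ (lam * rpow t (nu / 2)))
             (/ rpow (Rabs x) (2 / nu))).
Proof.
  assert (HX : 0 < Rabs x) by now apply Rabs_pos_lt.
  assert (HT : 0 < rpow t (nu / 2)) by (rewrite rpow_pos by auto; apply exp_pos).
  assert (HXp : 0 < rpow (Rabs x) (2 / nu)) by (rewrite rpow_pos by auto; apply exp_pos).
  assert (Hlp : 0 < rpow lam (2 / nu)) by (rewrite rpow_pos by auto; apply exp_pos).
  assert (HXs : rpow (Rabs x) (2 / nu + 1) = rpow (Rabs x) (2 / nu) * Rabs x) by apply pw_succ.
  assert (Hinv : forall v, 0 < v -> pw (nu / 2) (rpow v (2 / nu)) = v).
  { intros v Hv. rewrite rpow_pos, pw_pos, ln_exp by (auto; apply exp_pos).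
    rewrite <- (exp_ln v) at 2 by auto. f_equal. field. lra. }
  assert (HpX : pw (nu / 2) (/ rpow (Rabs x) (2 / nu)) = / Rabs x).
  { apply Rmult_eq_reg_r with (Rabs x); [| lra].
    rewrite <- (Hinv (Rabs x)) at 2 by auto.
    rewrite <- pw_mult, Rinv_l, Rinv_l by (auto; try lra; now apply Rinv_0_lt_compat).
    rewrite pw_pos, ln_1, Rmult_0_r by lra. apply exp_0. }
  split.
  (* With eta = 1, y^(nu/2) must be lambda t^(nu/2) / |x|. *)
  - rewrite (u_sol_stable_density lam nu x t 1 (rpow lam (2 / nu) * t / rpow (Rabs x) (2 / nu)));
      auto; try lra.
    + f_equal. f_equal. rewrite HXs. field. lra.
    + apply Rdiv_lt_0_compat; auto. now apply Rmult_lt_0_compat.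
    + change (rpow lam (2 / nu) * t / rpow (Rabs x) (2 / nu))
        with (rpow lam (2 / nu) * t * / rpow (Rabs x) (2 / nu)).
      rewrite !pw_mult, HpX, Hinv
        by (auto; try apply Rmult_lt_0_compat; auto; now apply Rinv_0_lt_compat).
      replace (pw (nu / 2) t) with (rpow t (nu / 2)) by (unfold pw; now rewrite Rabs_pos_eq by lra).
      field. lra.
  (* Here all dependence on t and lambda sits in eta, and y^(nu/2) = 1/|x|. *)
  - rewrite (u_sol_stable_density lam nu x t (/ (lam * rpow t (nu / 2)))
               (/ rpow (Rabs x) (2 / nu))); auto.
    + f_equal. f_equal. rewrite HXs. field. lra.
    + apply Rinv_0_lt_compat. now apply Rmult_lt_0_compat.
    + now apply Rinv_0_lt_compat.
    + rewrite HpX. field. lra.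
Qed.
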